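(* Let $p,\varepsilon\in(0,1)$ with $3p\varepsilon^2<1$, and consider the multitype Galton–Watson process $\{\boldsymbol Z_n\}$ with type set $\mathcal S=\{2,3,4,\dots\}$ and progeny generating functions $G_2(\boldsymbol s)=p\,s_4^3+(1-p)$ and, for $i\ge3$: if $i\in\{2^l\}_{l\ge2}$, $$G_i(\boldsymbol s)=\varepsilon p(1-3p\varepsilon^{i/2})\,s_{i-1}s_{2i}^3+p(1-3p\varepsilon^{i/2})(1-\varepsilon)\,s_{2i}^3+\varepsilon\bigl(1-p(1-3p\varepsilon^{i/2})\bigr)s_{i-1}+\bigl(1-\varepsilon-p(1-3p\varepsilon^{i/2})(1-\varepsilon)\bigr),$$ and otherwise $G_i(\boldsymbol s)=\varepsilon s_{i-1}+(1-\varepsilon)$. Then: (i) $\tilde{\boldsymbol q}=\boldsymbol1$; (ii) if $p>1/3$ then $\boldsymbol q<\boldsymbol1$; (iii) if $p<2/3$ and $\boldsymbol\alpha^{(k)}$ is the uniform distribution on the types $\{2,\dots,k\}$ for every $k\ge2$, then $\lim_{k\to\infty}\bar{\boldsymbol q}^{(k)}=\boldsymbol1$.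
   Context: A multitype Galton–Watson process $\{\boldsymbol Z_n\}_{n\ge0}$ with countable type set $\mathcal S$ starts from a single individual (type $\varphi_0$); each individual lives one generation and independently of all others produces offspring, a type-$i$ individual producing $r_j$ offspring of type $j$ ($j\in\mathcal S$) with probability $p_i(\boldsymbol r)$; its progeny generating function is $G_i(\boldsymbol s)=\sum_{\boldsymbol r}p_i(\boldsymbol r)\prod_js_j^{r_j}$. $Z_{n,j}$ is the number of type-$j$ individuals in generation $n$, $|\boldsymbol Z_n|=\sum_jZ_{n,j}$, and $\mathbf P_i(\cdot)=\mathbf P(\cdot\mid\varphi_0=i)$. The global and partial extinction probability vectors are $\boldsymbol q=(q_i)$, $q_i=\mathbf P_i(\lim_n|\boldsymbol Z_n|=0)$, and $\tilde{\boldsymbol q}=(\tilde q_i)$, $\tilde q_i=\mathbf P_i(\forall l\in\mathcal S:\lim_nZ_{n,l}=0)$. $\boldsymbol q<\boldsymbol 1$ means $q_i<1$ for every $i$. For $k\ge2$ and a probability distribution $\boldsymbol\alpha^{(k)}$ on $\{2,\dots,k\}$, $\{\bar{\boldsymbol Z}^{(k)}_n\}$ is the branching process in which types in $\{2,\dots,k\}$ have the same progeny distribution as in $\{\boldsymbol Z_n\}$, except that every individual of type larger than $k$ is instantaneously, and independently of everything else, replaced by an individual whose type is drawn from $\boldsymbol\alpha^{(k)}$; $\bar{\boldsymbol q}^{(k)}$, with $\bar q^{(k)}_i=\mathbf P_i(\lim_n|\bar{\boldsymbol Z}^{(k)}_n|=0)$ for $i\in\mathcal S$, is its extinction probability vector.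 Limits of vectors are entrywise. *)

(* Defs.v *)
(* MathComp / MathComp-Analysis *)
From HB Require Import structures.
From mathcomp Require Import all_boot all_order all_algebra.
From mathcomp Require Import finmap multiset.
From mathcomp Require Import all_classical all_reals all_analysis.
Import Order.TTheory GRing.Theory Num.Theory.
Import numFieldNormedType.Exports.

Set Implicit Arguments.
Unset Strict Implicit.
Unset Printing Implicit Defensive.

Local Open Scope mset_scope.
Local Open Scope classical_set_scope.
Local Open Scope ring_scope.

Section Independence.
Context {R : realType} {d : measure_display} {T : measurableType d}.
Variable P : probability T R.

(* Product rule over every finite subfamily; when each E i is a sigma-algebra
   this is mutual independence of the family E. *)
Definition mutually_independent (I : choiceType) (E : I -> set (set T)) : Prop :=
  forall (J : {fset I}) (A : I -> set T),
    (forall i, i \in J -> E i (A i)) ->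
    P (\bigcap_(i in [set` J]) A i) = (\prod_(i <- J) P (A i))%E.

(* The sigma-algebra generated by X, for a countable V with its discrete
   sigma-algebra. *)
Definition discrete_events (V : Type) (X : T -> V) : set (set T) :=
  [set X @^-1` B | B in [set: set V]].

Definition discrete_rv (V : Type) (X : T -> V) : Prop :=
  discrete_events X `<=` measurable.

Definition has_pmf (V : Type) (X : T -> V) (f : V -> R) : Prop :=
  forall v, P (X @^-1` [set v]) = (f v)%:E.

End Independence.

Definition is_pmf (R : realType) (V : choiceType) (f : V -> R) : Prop :=
  (forall v, 0 <= f v) /\ (\esum_(v in [set: V]) (f v)%:E = 1)%E.

(* A population, or an offspring vector r, is a finite multiset of types: r j is
   the number of individuals of type j, and size r is their total number. *)

(* The individuals of z are labelled by pairs (i, m) with m < z i; each is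
   replaced by the multiset f i m. *)
Definition mset_bind (S : choiceType) (f : S -> nat -> {mset S}) (z : {mset S}) :
  {mset S} :=
  (\big[msetD/mset0]_(i <- finsupp z) \big[msetD/mset0]_(m < z i) f i m).

Definition progeny_gf (R : realType) (S : choiceType) (f : {mset S} -> R)
  (s : S -> R) : \bar R :=
  (\esum_(r in [set: {mset S}]) (f r * \prod_(j <- finsupp r) s j ^+ r j)%:E)%E.

(* A multitype branching process with progeny distributions off : gw_xi n i m is
   the offspring of the m-th individual of type i living in generation n. *)
Record galton_watson (R : realType) (S : countType) (off : S -> {mset S} -> R) :=
  GaltonWatson {
    gw_disp : measure_display;
    gw_space : measurableType gw_disp;
    gw_P : probability gw_space R;
    gw_xi : nat -> S -> nat -> gw_space -> {mset S};
    gw_rv : forall n i m, discrete_rv (gw_xi n i m);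
    gw_law : forall n i m, has_pmf gw_P (gw_xi n i m) (off i);
    gw_indep : mutually_independent gw_P
      (fun e : nat * S * nat => discrete_events (gw_xi e.1.1 e.1.2 e.2))
  }.

Section Extinction.
Context {R : realType} {S : countType} {off : S -> {mset S} -> R}.
Variable Z : galton_watson off.

(* The population Z_n of the process started from one individual of type i. *)
Fixpoint gw_pop (i : S) (n : nat) (w : gw_space Z) : {mset S} :=
  if n is n'.+1
  then mset_bind (fun j m => gw_xi n' j m w) (gw_pop i n' w)
  else [mset i].

Definition global_extinction (i : S) : \bar R :=
  gw_P Z [set w | size (gw_pop i n w) @[n --> \oo] --> 0%N].

Definition partial_extinction (i : S) : \bar R :=
  gw_P Z [set w | forall l : S, gw_pop i n w l @[n --> \oo] --> 0%N].

End Extinction.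

Definition typ := {i : nat | (2 <= i)%N}.

(* The type with label n, for n >= 2 (and the type 2 otherwise). *)
Definition mkt (n : nat) : typ := insubd (exist _ 2%N isT : typ) n.

(* The process in which individuals of type > k are replaced: rp_xi is as
   gw_xi above, and rp_a n j m is the type replacing the m-th individual of
   type j among those about to enter generation n; it is used only for j > k. *)
Record replaced_gw (R : realType) (off : typ -> {mset typ} -> R) (k : nat)
    (alpha : typ -> R) :=
  ReplacedGW {
    rp_disp : measure_display;
    rp_space : measurableType rp_disp;
    rp_P : probability rp_space R;
    rp_xi : nat -> typ -> nat -> rp_space -> {mset typ};
    rp_a : nat -> typ -> nat -> rp_space -> typ;
    rp_xi_rv : forall n i m, discrete_rv (rp_xi n i m);
    rp_a_rv : forall n j m, discrete_rv (rp_a n j m);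
    rp_xi_law : forall n i m, has_pmf rp_P (rp_xi n i m) (off i);
    rp_a_law : forall n j m, has_pmf rp_P (rp_a n j m) alpha;
    rp_indep : mutually_independent rp_P
      (fun e : (nat * typ * nat) + (nat * typ * nat) =>
         match e with
         | inl x => discrete_events (rp_xi x.1.1 x.1.2 x.2)
         | inr x => discrete_events (rp_a x.1.1 x.1.2 x.2)
         end)
  }.

Section ReplacedExtinction.
Context {R : realType} {off : typ -> {mset typ} -> R} {k : nat}
  {alpha : typ -> R}.
Variable Z : replaced_gw off k alpha.

Definition replace_above (n : nat) (w : rp_space Z) (z : {mset typ}) :
  {mset typ} :=
  mset_bind (fun j m => if (val j <= k)%N then [mset j]
                        else [mset rp_a n j m w]) z.

Fixpoint rp_pop (i : typ) (n : nat) (w : rp_space Z) : {mset typ} :=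
  replace_above n w
    (if n is n'.+1
     then mset_bind (fun j m => rp_xi n' j m w) (rp_pop i n' w)
     else [mset i]).

Definition replaced_extinction (i : typ) : \bar R :=
  rp_P Z [set w | size (rp_pop i n w) @[n --> \oo] --> 0%N].

End ReplacedExtinction.

(* There are k - 1 types in {2, ..., k}. *)
Definition unif_upto (R : realType) (k : nat) (j : typ) : R :=
  if (val j <= k)%N then (k.-1)%:R^-1 else 0.

Definition dyadic_type (i : nat) : Prop :=
  exists2 l : nat, (2 <= l)%N & i = (2 ^ l)%N.

Definition example_gf (R : realType) (p eps : R) (i : typ) (s : typ -> R) : R :=
  let n := val i in
  let a := p * (1 - 3 * p * eps ^+ (n %/ 2)) in
  if n == 2%N then p * s (mkt 4) ^+ 3 + (1 - p)
  else if `[< dyadic_type n >] then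
    eps * a * s (mkt (n - 1)) * s (mkt (2 * n)) ^+ 3
    + a * (1 - eps) * s (mkt (2 * n)) ^+ 3
    + eps * (1 - a) * s (mkt (n - 1))
    + (1 - eps - a * (1 - eps))
  else eps * s (mkt (n - 1)) + (1 - eps).

(* Main.v *)
(* Let E_n(i, s) be the expectation of prod_j s_j ^ Z_{n,j} started from one
   individual of type i.  Conditioning on generation n gives
   E_{n+1}(i, s) = E_n(i, G(s)), so that E_n(., s) is the n-th iterate of G
   (composed with the averaging operator s_j -> mean of s over {2, ..., k}, for
   j > k, when types are replaced), and 1 - G(1 - y) <= M y for the mean matrix M.

   M has the exact positive solution M v = v given by v_{2^l} = (3p)^{-(l-1)} and
   v_i = eps v_{i-1} for the other i.  The v-transform of M is a chain which moves
   from 2^l to 2^{l+1} with probability 1 - eta_l and down to 2^{l-1} with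
   probability eta_l = 3p eps^{2^{l-1}}.  It is transient, hence has a bounded
   positive harmonic function x off 2 with x_1 > x_2, and u = v x satisfies
   1_{2} + M u <= u.  So the expected number of visits to type 2 is finite, and
   the same follows for every other type because u' = M u / eps satisfies
   1_{l+1} + M u' <= u' as soon as 1_{l} + M u <= u.  Borel-Cantelli gives (i).

   If p < 2/3 and 2^K <= k < 2^{K+1}, the mean of v over {2, ..., k} is
   O(b^K 2^{-K}) (3p)^{-K} for some b < 2, which for large k is below
   v_{2^{K+1}} / sup x.  Replacement therefore preserves 1_{2} + M u <= u, the
   expected number of generations in which the replaced process is alive is
   finite, and it dies out almost surely: the extinction probability is
   eventually equal to 1, which is (iii).

   For (ii), if 3p > 1 there are a > 1/3 and L such that a type-2^l individual
   with l >= L has three children of type 2^{l+1} with probability at least a;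
   as a s^3 + 1 - a <= s for s = 1/(3a) < 1, the iterates G^n(0) stay below s at
   these types.  Bounds below 1 then propagate downwards through the powers of 2,
   and from each 2^l to the other types between 2^l and 2^{l+1}. *)

Require Import Defs.
From HB Require Import structures.
From mathcomp Require Import all_boot all_order all_algebra.
From mathcomp Require Import finmap multiset.
From mathcomp Require Import all_classical all_reals all_analysis.
From mathcomp Require Import measurable_realfun ring lra zify.
Import Order.TTheory GRing.Theory Num.Theory.
Import numFieldNormedType.Exports.

Set Implicit Arguments.
Unset Strict Implicit.
Unset Printing Implicit Defensive.

Local Open Scope mset_scope.
Local Open Scope classical_set_scope.
Local Open Scope ring_scope.

(** * Partitions by a discrete random variable *)

Lemma esumZl (R : realType) (I : choiceType) (D : set I) (c : \bar R)
    (a : I -> \bar R) :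
  c \is a fin_num -> (0 <= c)%E -> (forall i, 0 <= a i)%E ->
  (\esum_(i in D) (c * a i) = c * \esum_(i in D) a i)%E.
Proof.
case: c => // r _; rewrite lee_fin => r0 a0.
rewrite /esum -ereal_supZl//; last first.
  by apply/set0P; exists (\sum_(i \in set0) a i)%E, set0 => //; exact: fsets_set0.
congr ereal_sup; rewrite image_comp; apply: eq_imagel => X _ /=.
by rewrite ge0_mule_fsumr.
Qed.

Section DiscreteRv.
Context {R : realType} {d : measure_display} {T : measurableType d}.
Implicit Types (P : probability T R) (A : set T).

Lemma discrete_rvP (V : Type) (X : T -> V) (B : set V) :
  discrete_rv X -> measurable (X @^-1` B).
Proof. by move=> mX; apply: mX; exists B. Qed.

Lemma discrete_rv_cst (V : Type) (v : V) : discrete_rv (fun _ : T => v).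
Proof. by move=> _ [B _ <-]; rewrite preimage_cst; case: ifP. Qed.

Lemma discrete_rv_comp (V W : Type) (X : T -> V) (g : V -> W) :
  discrete_rv X -> discrete_rv (fun w => g (X w)).
Proof.
by move=> mX _ [B _ <-]; exact: (@discrete_rvP _ X (g @^-1` B)).
Qed.

Lemma discrete_rv_measurable_fun (V : Type) (X : T -> V) (h : V -> \bar R) D :
  discrete_rv X -> measurable_fun D ((fun w => h (X w)) : T -> \bar R).
Proof.
by move=> mX mD Y _; apply: measurableI => //; exact: (@discrete_rvP _ X (h @^-1` Y)).
Qed.

(** A preimage under [Y] is the countable union of its slices over the values of [X]. This serves
    when [Y] is simple only once [X] is fixed, as for a generation given the previous one. *)
Lemma discrete_rv_countable (V W : choiceType) (X : T -> V) (Y : T -> W) :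
  countable [set: V] -> discrete_rv X ->
  (forall v B, measurable (X @^-1` [set v] `&` Y @^-1` B)) -> discrete_rv Y.
Proof.
move=> cV mX mXY _ [B _ <-].
rewrite (_ : Y @^-1` B =
  \bigcup_(v in [set: V]) (X @^-1` [set v] `&` Y @^-1` B)).
  by apply: countable_bigcupT_measurable.
by apply/seteqP; split=> [w Bw|w [v _ []//]]; exists (X w).
Qed.

Lemma ge0_integral_partition (V : choiceType) (X : T -> V) P A
    (f : T -> \bar R) :
  countable [set: V] -> discrete_rv X -> measurable A ->
  measurable_fun [set: T] f -> (forall w, 0 <= f w)%E ->
  (\int[P]_(w in A) f w =
   \esum_(v in [set: V]) \int[P]_(w in A `&` X @^-1` [set v]) f w)%E.
Proof.
move=> /countable_injP[c cinj] mX mA mf f0.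
have {}cinj : injective c by move=> x y; apply: cinj; rewrite inE.
(* The parts are reindexed by [nat] through the injection [c] to use additivity along a sequence; an
   index outside the range of [c] gives the empty part. *)
pose F i := A `&` X @^-1` (c @^-1` [set i]).
have mF i : measurable (F i) by apply: measurableI => //; exact: discrete_rvP.
have FA : \bigcup_i F i = A.
  by apply/seteqP; split=> [w [i _ []//]|w Aw]; exists (c (X w)).
rewrite -{1}FA ge0_integral_bigcup//; first last.
- by move=> i j _ _ [w [[_ /= <-] [_ /= <-]]].
- by rewrite FA; apply: measurable_funTS.
have i0 i : (0 <= \int[P]_(w in F i) f w)%E by exact: integral_ge0.
rewrite nneseries_esumT//.
rewrite [RHS](_ : _ = \esum_(v in [set: V]) \int[P]_(w in F (c v)) f w)%E; last first.
  apply: eq_esum => v _; congr (integral _ _ _).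
  by apply/seteqP; split=> w [Aw Xw]; split=> //=; [rewrite Xw|exact: cinj].
rewrite -(@esum_image _ _ _ _ c (fun i => \int[P]_(w in F i) f w)%E); last first.
  by move=> x y _ _ /cinj.
rewrite [RHS]esum_mkcond; apply: eq_esum => i _; case: ifPn => // ni.
rewrite (_ : F i = set0) ?integral_set0//.
apply/seteqP; split=> w //= [_ ci]; move: ni; rewrite notin_setE; apply.
by exists (X w).
Qed.

Lemma probability_partition (V : choiceType) (X : T -> V) P A :
  countable [set: V] -> discrete_rv X -> measurable A ->
  (P A = \esum_(v in [set: V]) P (A `&` X @^-1` [set v]))%E.
Proof.
move=> cV mX mA.
have mAX v : measurable (A `&` X @^-1` [set v]).
  by apply: measurableI => //; exact: discrete_rvP.
have := @ge0_integral_partition V X P A (cst 1%E) cV mX mA (measurable_cst _) (fun=> lee01).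
rewrite integral_cst// mul1e => ->; apply: eq_esum => v _.
by rewrite integral_cst// mul1e.
Qed.

Lemma integral_discrete (V : choiceType) (X : T -> V) P (h : V -> \bar R) :
  countable [set: V] -> discrete_rv X -> (forall v, 0 <= h v)%E ->
  (\int[P]_w h (X w) = \esum_(v in [set: V]) (h v * P (X @^-1` [set v])))%E.
Proof.
move=> cV mX h0.
rewrite (@ge0_integral_partition V X P setT (fun w => h (X w)))//; last first.
  exact: discrete_rv_measurable_fun.
apply: eq_esum => v _; rewrite setTI.
rewrite -(@integral_cst _ _ _ P _ (@discrete_rvP _ X [set v] mX) (h v)).
by apply: eq_integral => w /[!inE]/= ->.
Qed.

End DiscreteRv.

(** * Independence *)

Section Independence.
Context {R : realType} {d : measure_display} {T : measurableType d}.
Context {I V : choiceType} (P : probability T R) (X : I -> T -> V).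
Hypotheses (cV : countable [set: V]) (mX : forall i, discrete_rv (X i)).

(** When [P A > 0]: conditionally on [A], the variables indexed by [D] are still independent, with
    unchanged laws. Below, [A] fixes the current population and [D] indexes the variables not yet
    consumed. *)
Definition independent_of (D : set I) (A : set T) : Prop :=
  forall (J : {fset I}) (B : I -> set V), (forall j, j \in J -> D j) ->
  P (A `&` \bigcap_(j in [set` J]) (X j @^-1` B j)) =
  (P A * \prod_(j <- J) P (X j @^-1` B j))%E.

Lemma independent_ofT :
  mutually_independent P (fun i => discrete_events (X i)) ->
  independent_of [set: I] [set: T].
Proof.
move=> indX J B _; rewrite setTI probability_setT mul1e.
by apply: indX => i _; exists (B i).
Qed.

Lemma sub_independent_of (D D' : set I) (A : set T) :
  D' `<=` D -> independent_of D A -> independent_of D' A.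
Proof. by move=> DD' + J B JD; apply=> j /JD /DD'. Qed.

Lemma independent_of_preimage (D : set I) (A : set T) i (B : set V) :
  independent_of D A -> D i ->
  P (A `&` X i @^-1` B) = (P A * P (X i @^-1` B))%E.
Proof.
move=> indA Di; have := indA [fset i]%fset (fun=> B).
rewrite big_seq_fset1 => <-; last by move=> j /fset1P ->.
congr (P (A `&` _)); apply/seteqP; split=> w /=.
  by move=> Bw j /fset1P ->.
by apply; exact/fset1P.
Qed.

Lemma independent_of_setI (D : set I) (A : set T) i (B : set V) :
  independent_of D A -> D i ->
  independent_of (D `\ i) (A `&` X i @^-1` B).
Proof.
move=> indA Di J C JD.
have iJ : i \notin J by apply/negP => /JD [_]; exact.
(* The product rule is applied to the enlarged family, with [B] prescribed at the new index [i]. *)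
pose C' j := if j == i then B else C j.
have CC' j : j \in J -> C' j = C j.
  by rewrite /C'; case: eqVneq => // -> /JD [_ /(_ erefl)].
have := indA (i |` J)%fset C'.
rewrite big_fsetU1//= {2}/C' eqxx.
rewrite (independent_of_preimage B indA Di) -muleA.
have -> : (\prod_(j <- J) P (X j @^-1` C' j) = \prod_(j <- J) P (X j @^-1` C j))%E.
  by apply: eq_big_seq => j /CC' ->.
move=> <-; last by move=> j /fset1UP [->//|/JD []].
congr (P _); apply/seteqP; split=> w.
  move=> [[Aw Bw] Cw]; split=> // j /fset1UP [->|jJ] /=; first by rewrite /C' eqxx.
  by rewrite CC'//; exact: Cw.
move=> [Aw Cw]; split; first split => //.
  by have := Cw i; rewrite /C' /= eqxx; apply; exact: fset1U1.
by move=> j jJ; rewrite /= -CC'//; apply: Cw; exact: fset1Ur.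
Qed.

Lemma probability_prod_fin_num (J : {fset I}) (B : I -> set V) :
  (\prod_(j <- J) P (X j @^-1` B j))%E \is a fin_num.
Proof.
elim/big_ind: _ => // [x y|j _]; first exact: fin_numM.
by apply: fin_num_measure; exact: discrete_rvP.
Qed.

Lemma measurable_bigcap_preimage (J : {fset I}) (B : I -> set V) :
  measurable (\bigcap_(j in [set` J]) (X j @^-1` B j)).
Proof. by apply: fin_bigcap_measurable => // j _; exact: discrete_rvP. Qed.

(** Both sides of the product rule are countably additive in the event, so the rule may be checked
    on each value of [Y]. *)
Lemma independent_of_partition (W : choiceType) (Y : T -> W) (D : set I)
    (A : set T) :
  countable [set: W] -> discrete_rv Y -> measurable A ->
  (forall v, independent_of D (A `&` Y @^-1` [set v])) -> independent_of D A.
Proof.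
move=> cW mY mA indA J B JD.
rewrite (probability_partition _ cW mY); last first.
  by apply: measurableI => //; exact: measurable_bigcap_preimage.
rewrite [X in (X * _)%E](probability_partition _ cW mY)// muleC.
rewrite -esumZl//; first last.
- by apply: prode_ge0.
- exact: probability_prod_fin_num.
by apply: eq_esum => v _; rewrite setIAC indA// muleC.
Qed.

Lemma discrete_rv_seq (L : seq I) : discrete_rv (fun w => [seq X i w | i <- L]).
Proof.
elim: L => [|i L IHL] /=.
  exact: discrete_rv_cst.
apply: (discrete_rv_countable cV (@mX i)) => v B.
rewrite (_ : _ `&` _ = X i @^-1` [set v] `&`
    (fun w => [seq X j w | j <- L]) @^-1` [set s | B (v :: s)]).
  by apply: measurableI; [exact: discrete_rvP|apply: discrete_rvP].
by apply/seteqP; split=> w /= [Xw]; rewrite Xw.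
Qed.

(** The condition [Psi] on the joint values need not be a rectangle. Splitting by the value of the
    head variable absorbs it into [A] and leaves a condition on the tail. *)
Lemma independent_of_seq (D : set I) (A : set T) (L : seq I)
    (Psi : set (seq V)) :
  measurable A -> independent_of D A -> uniq L -> (forall i, i \in L -> D i) ->
  independent_of (D `\` [set` L])
    (A `&` (fun w => [seq X i w | i <- L]) @^-1` Psi).
Proof.
elim: L D A Psi => [|i L IHL] D A Psi mA indA.
  move=> _ _; have -> : D `\` [set` [::]] = D.
    by apply/seteqP; split=> j; [case|split].
  have [Psi0|Psi0] := pselect (Psi [::]).
    rewrite [X in independent_of _ X](_ : _ = A)//.
    by apply/seteqP; split=> [w []|].
  rewrite [X in independent_of _ X](_ : _ = set0).
    by move=> J B _; rewrite set0I measure0 mul0e.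
  by apply/seteqP; split=> [w []|].
move=> /= /andP[iL uL] LD.
apply: (independent_of_partition cV (@mX i)).
  apply: measurableI => //; apply: discrete_rvP.
  exact: (@discrete_rv_seq (i :: L)).
move=> v.
rewrite (_ : _ `&` _ `&` _ = A `&` X i @^-1` [set v] `&`
    (fun w => [seq X j w | j <- L]) @^-1` [set s | Psi (v :: s)]); last first.
  apply/seteqP; split=> w /=; first by move=> [[Aw +] Xw]; rewrite Xw.
  by move=> [[Aw Xw]]; rewrite Xw.
apply: (@sub_independent_of ((D `\ i) `\` [set` L])).
  move=> j [Dj jL]; split; first split => //.
    by move=> ji; apply: jL; rewrite /= ji mem_head.
  by move=> jL'; apply: jL; rewrite /= inE jL' orbT.
apply: IHL => //.
- by apply: measurableI => //; exact: discrete_rvP.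
- by apply: independent_of_setI => //; apply: LD; rewrite mem_head.
- move=> j jL; split; first by apply: LD; rewrite inE jL orbT.
  by move=> ji; move: iL; rewrite -ji jL.
Qed.

Lemma measurable_fun_prod_seq (K : Type) (e : K -> I) (h : K -> V -> R)
    (L : seq K) (C : set T) :
  measurable_fun C (fun w => (\prod_(x <- L) h x (X (e x) w))%:E).
Proof.
rewrite (_ : (fun _ => _) = (fun w => (\prod_(y <- zip L [seq X i w | i <- map e L])
    h y.1 y.2)%:E)); last first.
  apply/funext => w; congr EFin; elim: L => [|x L IHL]; first by rewrite !big_nil.
  by rewrite /= !big_cons IHL.
exact: (@discrete_rv_measurable_fun R d T (seq V)
  (fun w => [seq X i w | i <- map e L])
  (fun s => (\prod_(y <- zip L s) h y.1 y.2)%:E) C (@discrete_rv_seq (map e L))).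
Qed.

(** Induction on [L] for all events [A] at once: splitting by the value of the first variable
    absorbs it into the event. The bound [h x v <= 1] keeps the integrals finite, so that they can
    be moved out of the sums. *)
Lemma integral_prod_independent (K : Type) (e : K -> I) (h : K -> V -> R)
    (L : seq K) (D : set I) (A : set T) :
  (forall x v, 0 <= h x v <= 1) -> measurable A -> independent_of D A ->
  uniq (map e L) -> (forall i, i \in map e L -> D i) ->
  (\int[P]_(w in A) (\prod_(x <- L) h x (X (e x) w))%:E =
   P A * \prod_(x <- L) \int[P]_w (h x (X (e x) w))%:E)%E.
Proof.
move=> h01.
have h0 x v : 0 <= h x v by have /andP[] := h01 x v.
have prod0 L' w : 0 <= \prod_(x <- L') h x (X (e x) w).
  by apply: prodr_ge0.
have mh x C : measurable_fun C (fun w => (h x (X (e x) w))%:E).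
  exact: (@discrete_rv_measurable_fun _ _ _ _ _ (fun v => (h x v)%:E)).
have int_fin x : (\int[P]_w (h x (X (e x) w))%:E)%E \is a fin_num.
  rewrite ge0_fin_numE; last by apply: integral_ge0 => w _; rewrite lee_fin.
  apply: (@le_lt_trans _ _ (\int[P]_w (cst 1 w))%E); last first.
    rewrite integral_cst// mul1e.
    by apply: le_lt_trans (ltry 1); exact: probability_le1.
  by apply: ge0_le_integral => // w _; rewrite lee_fin//; have /andP[] := h01 x (X (e x) w).
elim: L D A => [|x L IHL] D A mA indA.
  move=> _ _; rewrite big_nil mule1; under eq_integral do rewrite big_nil.
  by rewrite integral_cst// mul1e.
move=> /= /andP[xL uL] LD.
have Dx : D (e x) by apply: LD; rewrite mem_head.
have prodx_fin : (\prod_(y <- L) \int[P]_w (h y (X (e y) w))%:E)%E \is a fin_num.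
  by elim/big_ind: _ => // a b; exact: fin_numM.
have prodx_ge0 : (0 <= \prod_(y <- L) \int[P]_w (h y (X (e y) w))%:E)%E.
  elim/big_ind: _ => // [a b|y _]; first exact: mule_ge0.
  by apply: integral_ge0 => w _; rewrite lee_fin.
rewrite (@ge0_integral_partition _ _ _ V (X (e x)))//; first last.
- by move=> w; rewrite lee_fin; exact: prod0 (x :: L) w.
- exact: (@measurable_fun_prod_seq _ e h (x :: L)).
rewrite big_cons (@integral_discrete _ _ _ V (X (e x)) P (fun v => (h x v)%:E))//;
  last by move=> v; rewrite lee_fin.
rewrite (muleC _ (\prod_(y <- L) _)%E) muleA -esumZl//; first last.
- by move=> v; rewrite mule_ge0// lee_fin.
- exact: mule_ge0.
- by rewrite fin_numM// fin_num_measure.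
apply: eq_esum => v _.
transitivity (\int[P]_(w in A `&` X (e x) @^-1` [set v])
    ((h x v)%:E * (\prod_(y <- L) h y (X (e y) w))%:E))%E.
  apply: eq_integral => w; rewrite inE => -[_ /= Xw].
  by rewrite big_cons Xw EFinM.
rewrite ge0_integralZl//; first last.
- by rewrite lee_fin.
- by move=> w _; rewrite lee_fin.
- exact: measurable_fun_prod_seq.
- by apply: measurableI => //; exact: discrete_rvP.
rewrite (IHL (D `\ e x))//; first last.
- move=> i iL; split; first by apply: LD; rewrite inE iL orbT.
  by move=> ix; move: xL; rewrite -ix iL.
- exact: independent_of_setI.
- by apply: measurableI => //; exact: discrete_rvP.
rewrite (independent_of_preimage _ indA Dx).
move: (P A) (P (X (e x) @^-1` _)) (h x v)%:E (\prod_(y <- L) _)%E => a b c p.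
by rewrite (muleC c (a * b * p)%E) (muleAC a) -(muleA (a * p)%E) (muleC b).
Qed.

End Independence.

(** * Generating functions of branching processes *)

Section MsetGf.
Context {R : realType} {S : choiceType}.
Implicit Types (s t : S -> R) (z : {mset S}).

HB.instance Definition _ := Monoid.isComLaw.Build {mset S} mset0 msetD
  msetDA msetDC mset0D.

Definition mset_monomial s z : R := \prod_(j <- finsupp z) s j ^+ z j.

Lemma mset_monomial_sub s z (F : {fset S}) :
  (finsupp z `<=` F)%fset -> mset_monomial s z = \prod_(j <- F) s j ^+ z j.
Proof.
move=> zF; rewrite /mset_monomial (big_fset_incl _ zF)// => j _ jz.
by rewrite (fsfun_dflt jz) expr0.
Qed.

Lemma mset_monomial0 s : mset_monomial s mset0 = 1.
Proof. by rewrite /mset_monomial finsupp0 big_seq_fset0. Qed.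

Lemma mset_monomialD s : {morph mset_monomial s : z1 z2 / (z1 `+` z2)%mset >-> z1 * z2}.
Proof.
move=> z1 z2; pose F := (finsupp z1 `|` finsupp z2)%fset.
rewrite (@mset_monomial_sub s z1 F) ?fsubsetUl//.
rewrite (@mset_monomial_sub s z2 F) ?fsubsetUr//.
rewrite (@mset_monomial_sub s _ F); last first.
  apply/fsubsetP => j; rewrite !inE !mem_finsupp msetE2 addn_eq0 negb_and.
  by [].
by rewrite -big_split; apply: eq_bigr => j _; rewrite msetE2 exprD.
Qed.

Lemma mset_monomial1 s j : mset_monomial s [mset j] = s j.
Proof. by rewrite /mset_monomial finsupp_msetn/= big_seq_fset1 msetnxx expr1. Qed.

Lemma mset_monomial_big s (K : Type) (L : seq K) (f : K -> {mset S}) :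
  mset_monomial s (\big[msetD/mset0]_(x <- L) f x) =
  \prod_(x <- L) mset_monomial s (f x).
Proof. exact: (big_morph _ (mset_monomialD s) (mset_monomial0 s)). Qed.

Lemma mset_monomial_itv s z :
  (forall j, 0 <= s j <= 1) -> 0 <= mset_monomial s z <= 1.
Proof.
move=> s01; apply/andP; split.
  by apply: prodr_ge0 => j _; rewrite exprn_ge0//; have /andP[] := s01 j.
apply: prodr_ile1 => j _; have /andP[sj0 sj1] := s01 j.
by rewrite exprn_ge0//= exprn_ile1.
Qed.

(** One duplicate-free list of individuals turns the nested operators of [mset_bind] into a single
    one. *)
Definition mset_labels z : seq (S * nat) :=
  [seq (j, m) | j <- finsupp z, m <- iota 0 (z j)].

Lemma mset_labels_uniq z : uniq (mset_labels z).
Proof.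
apply: allpairs_uniq_dep => [|j _|]; [exact: fset_uniq|exact: iota_uniq|].
by move=> [j1 m1] [j2 m2] _ _ /= [-> ->].
Qed.

Lemma mset_bindE (f : S -> nat -> {mset S}) z :
  mset_bind f z = \big[msetD/mset0]_(x <- mset_labels z) f x.1 x.2.
Proof.
rewrite /mset_bind big_allpairs_dep; apply: eq_bigr => j _.
transitivity (\big[msetD/mset0]_(0 <= m < z j) f j m); first by rewrite big_mkord.
by rewrite /index_iota subn0.
Qed.

Lemma prod_mset_labels s z :
  \prod_(x <- mset_labels z) s x.1 = mset_monomial s z.
Proof.
rewrite big_allpairs_dep; apply: eq_bigr => j _ /=.
by rewrite big_const_seq count_predT size_iota -Monoid.iteropE.
Qed.

End MsetGf.

Lemma mset_countable (S : countType) : countable [set: {mset S}].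
Proof.
apply/countable_injP; exists (fun z => choice.pickle (enum_mset z : seq S)) => z1 z2 _ _ /=.
move=> /(pcan_inj (@choice.pickleK _)) e.
by rewrite -(seq_mset_id z1) -(seq_mset_id z2) e.
Qed.

(** * One step of a branching process: measurability, independence, generating function *)

Section BranchingStep.
Context {R : realType} {d : measure_display} {T : measurableType d}.
Context {S : countType} {I : choiceType} (P : probability T R).
Context (X : I -> T -> {mset S}) (e : S -> nat -> I)
  (g : S -> {mset S} -> {mset S}) (Y : T -> {mset S}).
Hypotheses (mX : forall i, discrete_rv (X i)) (mY : discrete_rv Y)
  (e_inj : forall x y : S * nat, e x.1 x.2 = e y.1 y.2 -> x = y).

(** A common form for reproduction, where [g j] is the identity, and for replacement, where [g j]
    ignores its argument and returns [[mset j]] for a kept type [j]. *)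
Let Z w := mset_bind (fun j m => g j (X (e j m) w)) (Y w).

Let ex (x : S * nat) := e x.1 x.2.

Let bind_seq z (s : seq {mset S}) :=
  \big[msetD/mset0]_(y <- zip (mset_labels z) s) g y.1.1 y.2.

Let step_seqE z w : mset_bind (fun j m => g j (X (e j m) w)) z =
  bind_seq z [seq X i w | i <- map ex (mset_labels z)].
Proof.
rewrite mset_bindE /bind_seq; elim: (mset_labels z) => [|x L IHL] /=.
  by rewrite !big_nil.
by rewrite !big_cons IHL.
Qed.

(** Once [Y] equals [z], the next population depends only on the finitely many variables attached to
    the labels of [z]. *)
Let step_setE z (B : set {mset S}) : Y @^-1` [set z] `&` Z @^-1` B =
  Y @^-1` [set z] `&`
  (fun w => [seq X i w | i <- map ex (mset_labels z)]) @^-1`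
    (bind_seq z @^-1` B).
Proof.
apply/seteqP; split=> w [/= Yz] ZB; split=> //=; move: ZB.
  by rewrite /Z Yz step_seqE.
by rewrite /Z Yz step_seqE.
Qed.

Let measurable_Y z : measurable (Y @^-1` [set z]).
Proof. exact: discrete_rvP. Qed.

Lemma discrete_rv_step : discrete_rv Z.
Proof.
apply: (discrete_rv_countable (@mset_countable S) mY) => z B.
rewrite step_setE; apply: measurableI => //; apply: discrete_rvP.
exact: (discrete_rv_seq (@mset_countable S) mX).
Qed.

Let uniq_labels z : uniq (map ex (mset_labels z)).
Proof. by rewrite map_inj_uniq ?mset_labels_uniq// => x y /e_inj. Qed.

Variables (D D' : set I).
Hypotheses (De : forall j m, D (e j m))
  (indY : forall z, independent_of P X D (Y @^-1` [set z])).

Let De' z i : i \in map ex (mset_labels z) -> D i.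
Proof. by move=> /mapP[x _ ->]; exact: De. Qed.

(** Given [Y = z], the step consumes only variables of the form [e j m], all outside [D']; summing
    over [z] removes the conditioning. *)
Lemma independent_of_step : D' `<=` D -> (forall j m, ~ D' (e j m)) ->
  forall z, independent_of P X D' (Z @^-1` [set z]).
Proof.
move=> D'D eD' z'.
apply: (independent_of_partition mX (@mset_countable S) mY) => [|z].
  by apply: discrete_rvP; exact: discrete_rv_step.
rewrite setIC step_setE.
apply: (@sub_independent_of _ _ _ _ _ _ _ (D `\` [set` map ex (mset_labels z)])).
  move=> i D'i; split; first exact: D'D.
  by move=> /mapP[x _ ix]; apply: (eD' x.1 x.2); rewrite -/(ex x) -ix.
apply: (independent_of_seq (@mset_countable S) mX) => //.
exact: De'.
Qed.

(** The branching property: given [Y = z], the monomial of [Z] is a product of independent factors,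
    one for each label of [z], with mean [t j] at a label of type [j]. *)
Lemma mset_monomial_step (s t : S -> R) : (forall j, 0 <= s j <= 1) ->
  (forall j, 0 <= t j) ->
  (forall j m, \int[P]_w (mset_monomial s (g j (X (e j m) w)))%:E = (t j)%:E)%E ->
  (\int[P]_w (mset_monomial s (Z w))%:E =
   \int[P]_w (mset_monomial t (Y w))%:E)%E.
Proof.
move=> s01 t0 st.
have sge0 z : 0 <= mset_monomial s z.
  by have /andP[] := mset_monomial_itv z s01.
have tge0 z : 0 <= mset_monomial t z.
  by apply: prodr_ge0 => j _; exact: exprn_ge0.
rewrite (integral_discrete P (h := fun z => (mset_monomial t z)%:E)
  (@mset_countable S) mY)//.
rewrite (@ge0_integral_partition _ _ _ {mset S} Y P setT _ (@mset_countable S) mY)//; first last.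
- by move=> w; rewrite lee_fin.
- apply: (discrete_rv_measurable_fun (fun z => (mset_monomial s z)%:E)).
  exact: discrete_rv_step.
apply: eq_esum => z _; rewrite setTI.
pose h (x : S * nat) r := mset_monomial s (g x.1 r).
transitivity (\int[P]_(w in Y @^-1` [set z])
    (\prod_(x <- mset_labels z) h x (X (ex x) w))%:E)%E.
  apply: eq_integral => w; rewrite inE => /= Yz.
  by rewrite /Z Yz mset_bindE mset_monomial_big.
rewrite (integral_prod_independent (@mset_countable S) mX _ _ (@indY z))//.
- rewrite muleC; congr (_ * _)%E.
  rewrite (eq_bigr (fun x : S * nat => (t x.1)%:E)); last first.
    by move=> x _; exact: st.
  by rewrite prodEFin prod_mset_labels.
- by move=> x r; exact: mset_monomial_itv.
- exact: De'.
Qed.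

End BranchingStep.

Section MonomialIntegral.
Context {R : realType} {d : measure_display} {T : measurableType d}.
Context {S : countType} (P : probability T R).

Lemma integral_mset_monomial_itv (Y : T -> {mset S}) (s : S -> R) :
  discrete_rv Y -> (forall j, 0 <= s j <= 1) ->
  (0 <= \int[P]_w (mset_monomial s (Y w))%:E <= 1)%E.
Proof.
move=> mY s01.
have sitv z := mset_monomial_itv z s01.
apply/andP; split.
  by apply: integral_ge0 => w _; rewrite lee_fin; have /andP[] := sitv (Y w).
rewrite -(probability_setT P) -[P setT]mul1e -(@integral_cst _ _ _ P)//.
apply: ge0_le_integral => //.
- by move=> w _; rewrite lee_fin; have /andP[] := sitv (Y w).
- exact: (discrete_rv_measurable_fun (fun z => (mset_monomial s z)%:E)).
- by move=> w _; rewrite lee_fin; have /andP[] := sitv (Y w).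
Qed.

Lemma integral_mset_monomial_pmf (Y : T -> {mset S}) (f : {mset S} -> R)
    (s : S -> R) : discrete_rv Y -> has_pmf P Y f -> (forall j, 0 <= s j) ->
  (\int[P]_w (mset_monomial s (Y w))%:E = progeny_gf f s)%E.
Proof.
move=> mY Yf s0.
rewrite (integral_discrete P (h := fun z => (mset_monomial s z)%:E)
  (@mset_countable S) mY)//.
  by apply: eq_esum => z _; rewrite Yf -EFinM mulrC.
by move=> z; rewrite lee_fin; apply: prodr_ge0 => j _; exact: exprn_ge0.
Qed.

Lemma integral_mset_monomial_cst (z : {mset S}) (s : S -> R) :
  (\int[P]_w (mset_monomial s z)%:E = (mset_monomial s z)%:E)%E.
Proof.
have PT : P [set: T] = 1%E := probability_setT P.
by rewrite -[RHS]mule1 -PT; exact: integral_cst.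
Qed.

Lemma independent_of_cst (I : choiceType) (X : I -> T -> {mset S}) (D : set I)
    (z z' : {mset S}) :
  mutually_independent P (fun i => discrete_events (X i)) ->
  independent_of P X D ((fun=> z) @^-1` [set z']).
Proof.
move=> indX; rewrite preimage_cst; case: ifP => _.
  by apply: sub_independent_of (independent_ofT indX).
by move=> J B _; rewrite set0I measure0 mul0e.
Qed.

End MonomialIntegral.

(** * Generating functions of the generations of a Galton-Watson process *)

Section GaltonWatson.
Context {R : realType} {S : countType} {off : S -> {mset S} -> R}.
Variables (Z : galton_watson off) (G : (S -> R) -> S -> R).
Hypothesis offG : forall i s, (forall j, 0 <= s j <= 1) ->
  progeny_gf (off i) s = (G s i)%:E.

Let X (e : nat * S * nat) : gw_space Z -> {mset S} := gw_xi e.1.1 e.1.2 e.2.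
Let mX e : discrete_rv (X e). Proof. exact: gw_rv. Qed.
Let since n : set (nat * S * nat) := [set e | (n <= e.1.1)%N].

(** Generation [n] is built from offspring variables of earlier generations. Measurability and
    independence are proved together because one step needs both. *)
Lemma gw_pop_rv_independent i n : discrete_rv (@gw_pop R S off Z i n) /\
  forall z, independent_of (gw_P Z) X (since n) (@gw_pop R S off Z i n @^-1` [set z]).
Proof.
elim: n => [|n [mY indY]].
  split; first exact: discrete_rv_cst.
  by move=> z; apply: independent_of_cst; exact: gw_indep.
pose e j m : nat * S * nat := (n, j, m).
have e_inj (x y : S * nat) : e x.1 x.2 = e y.1 y.2 -> x = y.
  by case: x y => [j m] [j' m'] [-> ->].
split; first exact: (@discrete_rv_step _ _ _ _ X e (fun _ => id)).
apply: (@independent_of_step _ _ _ _ _ _ X e (fun _ => id) _ mX mY e_inj (since n)) => //.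
- by move=> j m; exact: leqnn.
- by move=> x; exact: ltnW.
- by move=> j m; rewrite /since /= ltnn.
Qed.

Lemma gw_pop_rv i n : discrete_rv (@gw_pop R S off Z i n).
Proof. by have [] := gw_pop_rv_independent i n. Qed.

(** The values of [G] are expectations of monomials in an offspring variable of the process, hence
    lie between 0 and 1. *)
Lemma offspring_gf_itv s : (forall j, 0 <= s j <= 1) -> forall j, 0 <= G s j <= 1.
Proof.
move=> s01 j; rewrite -!lee_fin -offG//.
rewrite -(@integral_mset_monomial_pmf _ _ _ _ (gw_P Z) (X (0, j, 0)))//.
- exact: integral_mset_monomial_itv.
- exact: gw_law.
- by move=> k; have /andP[] := s01 k.
Qed.

Lemma gw_pop_gf i n s : (forall j, 0 <= s j <= 1) ->
  (\int[gw_P Z]_w (mset_monomial s (gw_pop i n w))%:E = (iter n G s i)%:E)%E.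
Proof.
elim: n s => [|n IHn] s s01.
  by rewrite integral_mset_monomial_cst mset_monomial1.
rewrite iterSr -IHn; last exact: offspring_gf_itv.
have [mY indY] := gw_pop_rv_independent i n.
have s0 j : 0 <= s j by have /andP[] := s01 j.
pose e j m : nat * S * nat := (n, j, m).
apply: (@mset_monomial_step _ _ _ _ _ _ X e (fun _ => id) _ mX mY _ (since n)) => //.
- by move=> [j m] [j' m'] [-> ->].
- by move=> j m; exact: leqnn.
- by move=> j; have /andP[] := offspring_gf_itv s01 j.
- move=> j m; rewrite -offG//; apply: integral_mset_monomial_pmf => //.
  exact: gw_law.
Qed.

End GaltonWatson.

(** * Generating functions of the process with replacement *)

Section Replaced.
Context {R : realType} {off : typ -> {mset typ} -> R} {k : nat}
  {alpha : typ -> R}.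
Variables (Z : replaced_gw off k alpha) (G : (typ -> R) -> typ -> R)
  (avg : (typ -> R) -> R).
Hypothesis offG : forall i s, (forall j, 0 <= s j <= 1) ->
  progeny_gf (off i) s = (G s i)%:E.
Hypothesis alpha_avg : forall s, (forall j, 0 <= s j <= 1) ->
  (\esum_(j in [set: typ]) (s j * alpha j)%:E = (avg s)%:E)%E.

(** The generating function of the single individual that a type-[j] individual becomes after
    replacement. The predicate is a parameter so that the process without replacement is covered
    too. *)
Definition replace_mean (keep : pred typ) (s : typ -> R) (j : typ) : R :=
  if keep j then s j else avg s.

Let keep : pred typ := fun j => (val j <= k)%N.
Let Rm := replace_mean keep.

(** Replacing types are viewed as singleton multisets, so that both kinds of variables form one
    family with a common value type. *)
Let X (e : (nat * typ * nat) + (nat * typ * nat)) : rp_space Z -> {mset typ} :=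
  match e with
  | inl x => rp_xi x.1.1 x.1.2 x.2
  | inr x => fun w => [mset rp_a x.1.1 x.1.2 x.2 w]%mset
  end.

Let mX e : discrete_rv (X e).
Proof.
case: e => x; first exact: rp_xi_rv.
exact: (@discrete_rv_comp _ _ _ _ _ (fun j : typ => [mset j]%mset) (@rp_a_rv _ _ _ _ Z _ _ _)).
Qed.

Let indX : mutually_independent (rp_P Z) (fun e => discrete_events (X e)).
Proof.
move=> J A JA; apply: (rp_indep (r := Z)) => -[] x /JA //.
by move=> [B _ <-]; exists ((fun j : typ => [mset j]%mset) @^-1` B).
Qed.

Let before n : set ((nat * typ * nat) + (nat * typ * nat)) :=
  [set e | match e with inl x => (n <= x.1.1)%N | inr x => (n <= x.1.1)%N end].
Let after n : set ((nat * typ * nat) + (nat * typ * nat)) :=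
  [set e | match e with inl x => (n <= x.1.1)%N | inr x => (n < x.1.1)%N end].

Let pre i n (w : rp_space Z) : {mset typ} :=
  if n is n'.+1 then mset_bind (fun j m => rp_xi n' j m w) (rp_pop i n' w)
  else [mset i]%mset.

Let rp_popE i n w : rp_pop i n w = replace_above n w (pre i n w).
Proof. by case: n. Qed.

Let ea n (j : typ) m : (nat * typ * nat) + (nat * typ * nat) := inr (n, j, m).
Let ex n (j : typ) m : (nat * typ * nat) + (nat * typ * nat) := inl (n, j, m).
Let ga (j : typ) (r : {mset typ}) : {mset typ} :=
  if keep j then [mset j]%mset else r.

Let ea_inj n (x y : typ * nat) : ea n x.1 x.2 = ea n y.1 y.2 -> x = y.
Proof. by case: x y => [j m] [j' m'] [-> ->]. Qed.

Let ex_inj n (x y : typ * nat) : ex n x.1 x.2 = ex n y.1 y.2 -> x = y.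
Proof. by case: x y => [j m] [j' m'] [-> ->]. Qed.

Let pop_step i n : @rp_pop R off k alpha Z i n =
  (fun w => mset_bind (fun j m => ga j (X (ea n j m) w)) (pre i n w)).
Proof. by apply/funext => w; rewrite rp_popE. Qed.

Let replaced_step i n : discrete_rv (pre i n) ->
  (forall z, independent_of (rp_P Z) X (before n) (pre i n @^-1` [set z])) ->
  discrete_rv (@rp_pop R off k alpha Z i n) /\
  forall z, independent_of (rp_P Z) X (after n)
    (@rp_pop R off k alpha Z i n @^-1` [set z]).
Proof.
move=> mY indY; rewrite pop_step; split.
  exact: (@discrete_rv_step _ _ _ _ X (ea n) ga).
apply: (@independent_of_step _ _ _ _ _ _ X (ea n) ga _ mX mY (@ea_inj n) (before n)) => //.
- by move=> j m; exact: leqnn.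
- by move=> [] x //; exact: ltnW.
- by move=> j m; rewrite /after /= ltnn.
Qed.

Let pre_rv_independent i n : discrete_rv (pre i n) /\
  forall z, independent_of (rp_P Z) X (before n) (pre i n @^-1` [set z]).
Proof.
elim: n => [|n [mY indY]].
  split; first exact: discrete_rv_cst.
  by move=> z; exact: independent_of_cst.
have {mY indY} [mY indY] := replaced_step mY indY.
split; first exact: (@discrete_rv_step _ _ _ _ X (ex n) (fun _ => id)).
apply: (@independent_of_step _ _ _ _ _ _ X (ex n) (fun _ => id) _ mX mY (@ex_inj n) (after n)) => //.
- by move=> j m; exact: leqnn.
- by move=> [] x //; exact: ltnW.
- by move=> j m; rewrite /before /= ltnn.
Qed.

Lemma rp_pop_rv i n : discrete_rv (@rp_pop R off k alpha Z i n).
Proof.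
have [mY indY] := pre_rv_independent i n.
by have [] := replaced_step mY indY.
Qed.

Let G_itv s : (forall j, 0 <= s j <= 1) -> forall j, 0 <= G s j <= 1.
Proof.
move=> s01 j; rewrite -!lee_fin -offG//.
rewrite -(@integral_mset_monomial_pmf _ _ _ _ (rp_P Z) (X (ex 0 j 0)))//.
- exact: integral_mset_monomial_itv.
- exact: rp_xi_law.
- by move=> l; have /andP[] := s01 l.
Qed.

Let integral_replacement s n j m : (forall l, 0 <= s l <= 1) ->
  (\int[rp_P Z]_w (mset_monomial s (X (ea n j m) w))%:E = (avg s)%:E)%E.
Proof.
move=> s01; under eq_integral do rewrite /= mset_monomial1.
have s0 l : 0 <= s l by have /andP[] := s01 l.
have ctyp : countable [set: typ] by exact: countableP.
rewrite (integral_discrete (rp_P Z) (h := fun j => (s j)%:E) ctyp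
  (@rp_a_rv _ _ _ _ Z n j m))//.
by rewrite -alpha_avg//; apply: eq_esum => l _; rewrite rp_a_law EFinM.
Qed.

Let Rm_itv s : (forall j, 0 <= s j <= 1) -> forall j, 0 <= Rm s j <= 1.
Proof.
move=> s01 j; rewrite /Rm /replace_mean; case: ifP => // _.
rewrite -!lee_fin -(@integral_replacement s 0 j 0)//.
exact: integral_mset_monomial_itv.
Qed.

Let pop_gf_step i n s : (forall j, 0 <= s j <= 1) ->
  (\int[rp_P Z]_w (mset_monomial s (rp_pop i n w))%:E =
   \int[rp_P Z]_w (mset_monomial (Rm s) (pre i n w))%:E)%E.
Proof.
move=> s01; have [mY indY] := pre_rv_independent i n.
have s0 j : 0 <= s j by have /andP[] := s01 j.
rewrite pop_step.
apply: (@mset_monomial_step _ _ _ _ _ _ X (ea n) ga _ mX mY (@ea_inj n) (before n)) => //.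
- by move=> j m; exact: leqnn.
- by move=> j; have /andP[] := Rm_itv s01 j.
- move=> j m; rewrite /ga /Rm /replace_mean; case: ifP => _.
    by rewrite integral_mset_monomial_cst mset_monomial1.
  exact: integral_replacement.
Qed.

(** Each generation contributes an offspring step composed with a replacement step; the outermost
    [Rm] is the replacement of the ancestor itself. *)
Lemma rp_pop_gf i n s : (forall j, 0 <= s j <= 1) ->
  (\int[rp_P Z]_w (mset_monomial s (rp_pop i n w))%:E =
   (Rm (iter n (fun t => G (Rm t)) s) i)%:E)%E.
Proof.
elim: n s => [|n IHn] s s01; rewrite pop_gf_step//.
  by rewrite integral_mset_monomial_cst mset_monomial1.
rewrite iterSr -IHn; last by apply: G_itv; exact: Rm_itv.
have [mY indY] := pre_rv_independent i n.
have {mY indY} [mY indY] := replaced_step mY indY.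
have Rs01 := Rm_itv s01.
have Rs0 j : 0 <= Rm s j by have /andP[] := Rs01 j.
apply: (@mset_monomial_step _ _ _ _ _ _ X (ex n) (fun _ => id) _ mX mY (@ex_inj n) (after n)) => //.
- by move=> j m; exact: leqnn.
- by move=> j; have /andP[] := G_itv Rs01 j.
- move=> j m; rewrite -offG//; apply: integral_mset_monomial_pmf => //.
  exact: rp_xi_law.
Qed.

End Replaced.

(** * The mean matrix and its potentials *)

Lemma val_mkt n : (2 <= n)%N -> val (mkt n) = n.
Proof. by move=> n2; rewrite /mkt insubdK. Qed.

Lemma mkt_val (i : typ) : mkt (val i) = i.
Proof. by apply: val_inj; rewrite val_mkt//; exact: valP. Qed.

Lemma dyadic_pow l : (2 <= l)%N -> dyadic_type (2 ^ l)%N.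
Proof. by move=> l2; exists l. Qed.

Lemma trunc_log_pow2 l n : (2 ^ l <= n < 2 ^ l.+1)%N -> trunc_log 2 n = l.
Proof. exact: trunc_log_eq. Qed.

Lemma non_dyadic_ltn n : (3 <= n)%N -> ~ dyadic_type n ->
  (2 ^ trunc_log 2 n < n)%N.
Proof.
move=> n3 ndy; have /andP[le _] := @trunc_log_bounds 2 n isT (ltn_trans (ltn0Sn _) n3).
rewrite ltn_neqAle le andbT; apply/eqP => e; apply: ndy.
exists (trunc_log 2 n) => //.
by case: (trunc_log 2 n) e => [|[|l]] //= e; move: n3; rewrite -e.
Qed.

(* A bounded function, harmonic off 1, for the transient walk which moves from l
   to l + 1 with probability 1 - eta l and to l - 1 with probability eta l. *)
Lemma transient_barrier (R : realType) (eta : nat -> R) (L : nat) :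
  (forall l, (2 <= l)%N -> 0 <= eta l < 1) ->
  (forall l, (L <= l)%N -> eta l <= 3^-1) ->
  exists (x : nat -> R) (B : R), [/\ forall l, 1 <= x l <= B, x 1 - x 2 = 1 &
    forall l, (2 <= l)%N -> (1 - eta l) * x l.+1 + eta l * x l.-1 = x l].
Proof.
move=> eta01 etaL.
(* Harmonicity says that the decrements [x l - x l.+1] have successive ratios [eta l / (1 - eta l)];
   [d] is the solution with [d 1 = 1], and [S] sums the decrements. *)
pose d l : R := \prod_(2 <= m < l.+1) (eta m / (1 - eta m)).
pose S l : R := \sum_(1 <= m < l) d m.
have d_ge0 l : 0 <= d l.
  rewrite /d big_nat_cond; apply: prodr_ge0 => m /andP[/andP[m2 _] _].
  by have /andP[e0 e1] := eta01 m m2; rewrite divr_ge0//; lra.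
have dS l : (1 <= l)%N -> d l.+1 = d l * (eta l.+1 / (1 - eta l.+1)).
  by move=> l1; rewrite /d big_nat_recr.
have SS l : (1 <= l)%N -> S l.+1 = S l + d l.
  by move=> l1; rewrite /S big_nat_recr.
have S_ge0 l : 0 <= S l by apply: sumr_ge0.
pose M := L.+2.
(* Where [eta] is at most 1/3 the ratios are at most 1/2, so [S l + 2 * d l] no longer increases;
   this bounds [S]. *)
have SM l : (M <= l)%N -> S l + 2 * d l <= S M + 2 * d M.
  move=> /subnKC <-; elim: (l - M)%N => [|j IHj]; first by rewrite addn0.
  rewrite addnS; apply: le_trans IHj.
  rewrite dS// SS//.
  have /andP[e0 e1] := eta01 (M + j).+1 isT.
  have e3 : eta (M + j).+1 <= 3^-1 by apply: etaL; rewrite /M; lia.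
  have r2 : eta (M + j).+1 / (1 - eta (M + j).+1) <= 2^-1.
    by rewrite ler_pdivrMr; lra.
  have := d_ge0 (M + j)%N; nra.
have S_le l : S l <= S M + 2 * d M.
  have [lM|Ml] := leqP M l; first by apply: le_trans (SM l lM); rewrite lerDl mulr_ge0.
  have S_incr j : S j <= S j.+1.
    have [j1|] := leqP 1 j; first by rewrite SS// lerDl.
    by rewrite ltnS leqn0 => /eqP ->; rewrite /S !big_geq.
  have S_mono : {homo S : a b / (a <= b)%N >-> a <= b}.
    by apply: homo_leq => //; exact: le_trans.
  by apply: le_trans (S_mono _ _ (ltnW Ml)) _; rewrite lerDl mulr_ge0.
(* The added 1 turns the bound on [S] into [x l >= 1]. *)
exists (fun l => S M + 2 * d M + 1 - S l), (S M + 2 * d M + 1); split.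
- by move=> l; have := S_ge0 l; have := S_le l; lra.
- rewrite (SS 1)//; have -> : d 1 = 1 by rewrite /d big_geq.
  lra.
- move=> [|[|l]]// _; rewrite (SS l.+2)// (SS l.+1)// [d l.+2]dS//=.
  have /andP[e0 e1] := eta01 l.+2 isT.
  have e1' : 1 - eta l.+2 != 0 by lra.
  field.
  exact: e1'.
Qed.

(** * Averages over the types from 2 to [k] *)

Section UniformMean.
Context {R : realType}.
Implicit Types (k : nat) (s : typ -> R).

Definition unif_mean k s : R :=
  (\sum_(2 <= n < k.+1) s (mkt n)) / (k.-1)%:R.

Lemma unif_mean_le k s s' :
  (forall j, (val j <= k)%N -> s j <= s' j) -> unif_mean k s <= unif_mean k s'.
Proof.
move=> ss'; rewrite /unif_mean ler_wpM2r ?invr_ge0//.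
rewrite big_nat_cond [leRHS]big_nat_cond; apply: ler_sum => n /andP[/andP[n2 nk] _].
by apply: ss'; rewrite val_mkt.
Qed.

Lemma unif_meanD k s s' :
  unif_mean k (fun j => s j + s' j) = unif_mean k s + unif_mean k s'.
Proof. by rewrite /unif_mean big_split/= mulrDl. Qed.

Lemma unif_meanZ k c s : unif_mean k (fun j => c * s j) = c * unif_mean k s.
Proof. by rewrite /unif_mean -mulr_sumr mulrA. Qed.

Lemma unif_mean_cst k c : (2 <= k)%N -> unif_mean k (fun=> c) = c.
Proof.
move=> k2; rewrite /unif_mean sumr_const_nat.
have -> : (k.+1 - 2 = k.-1)%N by lia.
by rewrite -[c *+ _]mulr_natr mulfK// pnatr_eq0; lia.
Qed.

Lemma unif_mean_esum k s : (2 <= k)%N -> (forall j, 0 <= s j) ->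
  (\esum_(j in [set: typ]) (s j * unif_upto R k j)%:E = (unif_mean k s)%:E)%E.
Proof.
move=> k2 s0; pose A : set nat := [set` index_iota 2 k.+1].
pose f j : \bar R := (s j * unif_upto R k j)%:E.
have f0 j : (0 <= f j)%E.
  by rewrite lee_fin mulr_ge0// /unif_upto; case: ifP => // _; rewrite invr_ge0.
transitivity (\esum_(j in mkt @` A) f j)%E.
  rewrite [RHS]esum_mkcond; apply: eq_esum => j _; case: ifPn => // jA.
  rewrite /f /unif_upto; case: ifPn => [jk|_]; last by rewrite mulr0.
  move: jA; rewrite notin_setE => -[]; exists (val j); last exact: mkt_val.
  by rewrite /A /= mem_index_iota (valP j).
rewrite (@esum_image _ _ _ _ mkt); last first.
  move=> m n; rewrite !inE /A /= !mem_index_iota => /andP[m2 _] /andP[n2 _] mn.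
  by rewrite -(val_mkt m2) mn val_mkt.
rewrite esum_fset//; last exact: finite_seq.
rewrite -fsbig_seq ?iota_uniq//.
rewrite /unif_mean mulr_suml -sumEFin big_seq [RHS]big_seq.
apply: eq_bigr => n; rewrite mem_index_iota => /andP[n2 nk].
by rewrite /f /unif_upto val_mkt// -ltnS nk.
Qed.

End UniformMean.

(** * The mean matrix and the first-moment bound *)

Section MeanOperator.
Context {R : realType} (p eps : R).
Hypotheses (hp : 0 < p < 1) (heps : 0 < eps < 1) (hpe : 3 * p * eps ^+ 2 < 1).

Let p0 : 0 < p. Proof. by have /andP[] := hp. Qed.
Let p1 : p < 1. Proof. by have /andP[] := hp. Qed.
Let eps0 : 0 < eps. Proof. by have /andP[] := heps. Qed.
Let eps1 : eps < 1. Proof. by have /andP[] := heps. Qed.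

(** With [a = triple_prob n], the generating function at a dyadic type [n] factors as [(eps s_(n-1)
    + 1 - eps) (a s_(2n)^3 + 1 - a)]: the child of type [n - 1] and the three children of type [2n]
    occur independently. *)
Definition triple_prob (n : nat) : R := p * (1 - 3 * p * eps ^+ (n %/ 2)).

(** From [n = 4] on the exponent of [eps] is at least 2, so [hpe] controls the factor. *)
Lemma triple_prob_itv n : (4 <= n)%N -> 0 <= triple_prob n <= 1.
Proof.
move=> n4; rewrite /triple_prob.
have e2 : eps ^+ (n %/ 2) <= eps ^+ 2.
  by rewrite ler_wiXn2l ?ltW//; lia.
have e0 : 0 <= eps ^+ (n %/ 2) by rewrite exprn_ge0// ltW.
move: (eps ^+ (n %/ 2)) e2 e0 => c e2 e0.
have pc : p * c <= p * eps ^+ 2 by rewrite ler_wpM2l// ltW.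
have pc0 : 0 <= p * c by rewrite mulr_ge0// ltW.
have q0 : 0 <= 1 - 3 * p * c by move: hpe; lra.
apply/andP; split; first by rewrite mulr_ge0// ltW.
apply: le_trans (ltW p1); apply: ler_piMr; [exact: ltW|lra].
Qed.

Lemma dyadic_ge4 n : dyadic_type n -> (4 <= n)%N.
Proof. by move=> [l l2 ->]; exact: (@leq_pexp2l 2 2 l). Qed.

(** The mean progeny matrix [M] acting on the column vector [y]. *)
Definition mean_op (y : typ -> R) (i : typ) : R :=
  let n := val i in
  if n == 2%N then 3 * p * y (mkt 4)
  else if `[< dyadic_type n >] then
    eps * y (mkt (n - 1)) + 3 * triple_prob n * y (mkt (2 * n))
  else eps * y (mkt (n - 1)).

Lemma mean_op_le y y' : (forall j, y j <= y' j) ->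
  forall i, mean_op y i <= mean_op y' i.
Proof.
move=> yy' i; rewrite /mean_op; case: ifP => _.
  by rewrite ler_wpM2l// mulr_ge0// ltW.
case: ifPn => [/asboolP/dyadic_ge4/triple_prob_itv/andP[a0 _]|_].
  apply: lerD; first by rewrite ler_wpM2l// ltW.
  by rewrite ler_wpM2l// mulr_ge0.
by rewrite ler_wpM2l// ltW.
Qed.

Lemma mean_opD y y' i :
  mean_op (fun j => y j + y' j) i = mean_op y i + mean_op y' i.
Proof. by rewrite /mean_op; case: ifP => _; [ring|case: ifP => _; ring]. Qed.

Lemma mean_opZ c y i : mean_op (fun j => c * y j) i = c * mean_op y i.
Proof. by rewrite /mean_op; case: ifP => _; [ring|case: ifP => _; ring]. Qed.

Lemma mean_op_ge0 y : (forall j, 0 <= y j) -> forall i, 0 <= mean_op y i.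
Proof.
move=> y0 i; apply: le_trans (mean_op_le (y := fun=> 0) y0 i).
by rewrite /mean_op !mulr0 addr0; case: ifP => _; [|case: ifP => _].
Qed.

Let cube_bound (t : R) : 0 <= t <= 1 -> 0 <= 1 - t ^+ 3 <= 3 * (1 - t).
Proof.
move=> /andP[t0 t1].
have -> : 1 - t ^+ 3 = (1 + t + t ^+ 2) * (1 - t) by ring.
have t2 : t ^+ 2 <= 1 by rewrite exprn_ile1.
have t20 : 0 <= t ^+ 2 by rewrite exprn_ge0.
by rewrite mulr_ge0 ?subr_ge0//=; [rewrite ler_wpM2r ?subr_ge0//; lra|lra].
Qed.

Lemma example_gf_mean_op s : (forall j, 0 <= s j <= 1) ->
  forall i, 1 - example_gf p eps i s <= mean_op (fun j => 1 - s j) i.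
Proof.
move=> s01 i; rewrite /example_gf /mean_op; cbv beta zeta; case: ifP => _.
  have /andP[_ c1] := cube_bound (s01 (mkt 4)).
  have : p * (1 - s (mkt 4) ^+ 3) <= p * (3 * (1 - s (mkt 4))).
    by rewrite ler_wpM2l// ltW.
  lra.
have := s01 (mkt (val i - 1)); move: (s (mkt (val i - 1))) => a /andP[a0 a1].
case: ifPn => [/asboolP/dyadic_ge4/triple_prob_itv|_]; last by nra.
rewrite -/(triple_prob (val i)); move: (triple_prob (val i)) => b /andP[b0 b1].
have /andP[] := cube_bound (s01 (mkt (2 * val i))).
move: (s _) => t; move: (t ^+ 3) => c c0 c1.
(* The cross term in the expansion of the factored generating function; dropping it is the union
   bound over the two kinds of children. *)
have : 0 <= (1 - a) * (b * (1 - c)) * eps.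
  by apply: mulr_ge0; [apply: mulr_ge0; [lra|exact: mulr_ge0]|exact: ltW].
have : b * (1 - c) <= b * (3 * (1 - t)) by rewrite ler_wpM2l.
lra.
Qed.

End MeanOperator.

Definition type_indic (R : realType) (l : nat) (j : typ) : R := (val j == l)%:R.

(* The process without replacement corresponds to keep = xpredT. *)
Section Potential.
Context {R : realType} (p eps : R).
Hypotheses (hp : 0 < p < 1) (heps : 0 < eps < 1) (hpe : 3 * p * eps ^+ 2 < 1).
Variables (keep : pred typ) (k : nat).
Hypotheses (k2 : (2 <= k)%N) (keepk : forall j : typ, (val j <= k)%N -> keep j)
  (keepS : forall n, (2 <= n)%N -> keep (mkt n.+1) -> keep (mkt n)).

Let Rm : (typ -> R) -> typ -> R := replace_mean (unif_mean k) keep.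
Let N y := mean_op p eps (Rm y).

(** Comparison on kept types suffices because the average runs over types up to [k], all of them
    kept. *)
Lemma replace_mean_le y y' : (forall j, keep j -> y j <= y' j) ->
  forall j, Rm y j <= Rm y' j.
Proof.
move=> yy' j; rewrite /Rm /replace_mean; case: ifP => [|_]; first exact: yy'.
by apply: unif_mean_le => i /keepk; exact: yy'.
Qed.

Lemma replace_meanD y y' : Rm (fun j => y j + y' j) = (fun j => Rm y j + Rm y' j).
Proof.
by apply/funext => j; rewrite /Rm /replace_mean; case: ifP; rewrite // unif_meanD.
Qed.

Lemma replace_meanZ c y : Rm (fun j => c * y j) = (fun j => c * Rm y j).
Proof.
by apply/funext => j; rewrite /Rm /replace_mean; case: ifP; rewrite // unif_meanZ.
Qed.

Lemma replace_mean_cst c : Rm (fun=> c) = (fun=> c).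
Proof.
by apply/funext => j; rewrite /Rm /replace_mean unif_mean_cst//; case: ifP.
Qed.

Let N_le y y' : (forall j, keep j -> y j <= y' j) -> forall i, N y i <= N y' i.
Proof. by move=> yy'; apply: mean_op_le => //; exact: replace_mean_le. Qed.

Let ND y y' i : N (fun j => y j + y' j) i = N y i + N y' i.
Proof. by rewrite /N replace_meanD mean_opD. Qed.

Let NZ c y i : N (fun j => c * y j) i = c * N y i.
Proof. by rewrite /N replace_meanZ mean_opZ. Qed.

Let N_ge0 y : (forall j, 0 <= y j) -> forall i, 0 <= N y i.
Proof.
move=> y0 i; apply: mean_op_ge0 => // j.
rewrite -[leLHS](_ : Rm (fun=> 0) j = 0); first exact: replace_mean_le.
by rewrite replace_mean_cst.
Qed.

(** The partial sums of the Green function of [N] are the iterates of [y |-> f + N y] from 0, by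
    linearity; by monotonicity these stay below any nonnegative supersolution [u]. *)
Lemma sum_iter_le_potential (f u : typ -> R) :
  (forall j, 0 <= u j) -> (forall i, keep i -> f i + N u i <= u i) ->
  forall m i, keep i -> \sum_(n < m) iter n N f i <= u i.
Proof.
move=> u0 fNu m i ki.
pose t m := iter m (fun y j => f j + N y j) (fun=> 0).
have tu j : forall i, keep i -> t j i <= u i.
  elim: j => [i' _|j IHj i' ki']; first exact: u0.
  by apply: le_trans (fNu i' ki'); rewrite lerD2l; exact: N_le.
suff -> : \sum_(n < m) iter n N f i = t m i by exact: tu.
have tS j : t j.+1 = fun i => t j i + iter j N f i.
  elim: j => [|j IHj]; apply/funext => i'.
    rewrite /= add0r -[RHS]addr0; congr (_ + _).
    by have := NZ 0 (fun=> 0) i'; rewrite !mul0r.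
  rewrite [LHS](_ : _ = f i' + N (t j.+1) i')//.
  by rewrite [in LHS]IHj ND addrA.
elim: m => [|m IHm]; first by rewrite big_ord0.
by rewrite tS big_ord_recr IHm.
Qed.

(** Every type above 2 has on average [eps] children of the type just below, and [keepS] saves such
    a child from replacement. *)
Let indic_step l i : (2 <= l)%N -> keep i ->
  eps * type_indic R l.+1 i <= N (type_indic R l) i.
Proof.
move=> l2 ki; have ge0 : forall j, 0 <= type_indic R l j by [].
rewrite {1}/type_indic; case: eqP => [il|_]; last by rewrite mulr0 N_ge0.
have kl : keep (mkt l) by apply: keepS => //; rewrite -il mkt_val.
have Rl : Rm (type_indic R l) (mkt l) = 1.
  by rewrite /Rm /replace_mean kl /type_indic val_mkt// eqxx.
have R0 j : 0 <= Rm (type_indic R l) j.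
  rewrite -[leLHS](_ : Rm (fun=> 0) j = 0); first exact: replace_mean_le.
  by rewrite replace_mean_cst.
rewrite /N /mean_op il subn1 /= Rl ifF; last by lia.
case: ifPn => // /asboolP/dyadic_ge4/(triple_prob_itv hp heps hpe)/andP[a0 _].
by rewrite lerDl; apply: mulr_ge0 => //; exact: mulr_ge0.
Qed.

(** Induction on [l]: applying [N] to the inequality for [l] and bounding [N] of the indicator below
    by [indic_step] gives the inequality for [l.+1], up to the factor [eps]. *)
Lemma potential_all_types (u2 : typ -> R) :
  (forall j, 0 <= u2 j) ->
  (forall i, keep i -> type_indic R 2 i + N u2 i <= u2 i) ->
  forall l, (2 <= l)%N -> exists u : typ -> R, (forall j, 0 <= u j) /\
    forall i, keep i -> type_indic R l i + N u i <= u i.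
Proof.
move=> u20 hu2; have eps0 : 0 < eps by have /andP[] := heps.
elim=> [//|l IHl] l1.
have [l2|] := leqP 2 l; last first.
  by rewrite ltnS => l1'; exists u2; have -> : l = 1%N by lia.
have [u [u0 hu]] := IHl l2.
exists (fun j => eps^-1 * N u j); split.
  by move=> j; apply: mulr_ge0; [rewrite invr_ge0 ltW|exact: N_ge0].
move=> i ki; rewrite NZ -(ler_pM2l eps0) mulrDr !mulrA mulfV ?gt_eqF// !mul1r.
apply: le_trans (N_le hu i); rewrite ND lerD2r.
exact: indic_step.
Qed.

(** Iterates the one-step first-moment bound. Values in the unit interval are carried in the same
    induction, since that bound requires them. *)
Lemma iter_gf_le_iter_mean (s : typ -> R) :
  let H t := example_gf p eps ^~ (Rm t) in
  (forall t, (forall j, 0 <= t j <= 1) ->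
     forall j, 0 <= example_gf p eps j t <= 1) ->
  (forall j, 0 <= s j <= 1) ->
  forall n i, 0 <= iter n H s i <= 1 /\
    1 - iter n H s i <= iter n N (fun j => 1 - s j) i.
Proof.
move=> H gf01 s01; elim=> [//|n IHn] i /=.
have R01 j : 0 <= Rm (iter n H s) j <= 1.
  have /(_ j) := @replace_mean_le (fun=> 0) (iter n H s)
    (fun j _ => proj1 (andP (proj1 (IHn j)))).
  have /(_ j) := @replace_mean_le (iter n H s) (fun=> 1)
    (fun j _ => proj2 (andP (proj1 (IHn j)))).
  by rewrite !replace_mean_cst => -> ->.
split; first exact: gf01.
apply: le_trans (example_gf_mean_op hp heps hpe R01 i) _.
have -> : (fun j => 1 - Rm (iter n H s) j) = Rm (fun j => 1 - iter n H s j).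
  rewrite (_ : (fun j => 1 - iter n H s j) = fun j => 1 + -1 * iter n H s j).
    rewrite replace_meanD replace_mean_cst replace_meanZ.
    by apply/funext => j; rewrite mulN1r.
  by apply/funext => j; rewrite mulN1r.
by apply: N_le => j _; have [] := IHn j.
Qed.

End Potential.

Lemma geometric_le (R : realType) (r del : R) : 0 <= r < 1 -> 0 < del ->
  exists L, forall n, (L <= n)%N -> r ^+ n <= del.
Proof.
move=> /andP[r0 r1] del0.
have /cvgr0_norm_le/(_ _ del0)[L _ HL] : (r ^+ n) @[n --> \oo] --> (0 : R).
  by apply: cvg_expr; rewrite ger0_norm.
by exists L => n /HL; apply: le_trans; exact: ler_norm.
Qed.

Lemma trunc_log_pow_pred l : (2 <= l)%N -> trunc_log 2 (2 ^ l - 1) = l.-1.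
Proof.
case: l => [//|l] l2; apply: trunc_log_pow2.
have l0 : (2 ^ 1 <= 2 ^ l)%N by rewrite leq_exp2l.
by rewrite /= !expnS; lia.
Qed.

(** * The harmonic vector of the mean matrix and the potential of type 2 *)

Section Weight.
Context {R : realType} (p eps : R).
(* Probability of a move from 2^l down to 2^(l-1) in the transform of the mean
   matrix by its harmonic vector [weight]. *)
Definition down_prob (l : nat) : R := 3 * p * eps ^+ (2 ^ l.-1)%N.

(* The positive fixed vector of the mean matrix, normalised at type 2. *)
Definition weight (n : nat) : R :=
  ((3 * p)^-1) ^+ (trunc_log 2 n).-1 * eps ^+ (n - 2 ^ trunc_log 2 n).

Lemma weight_pow l : weight (2 ^ l) = ((3 * p)^-1) ^+ l.-1.
Proof.
by rewrite /weight (@trunc_log_pow2 l) ?subnn ?mulr1// leqnn ltn_exp2l/=.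
Qed.

(** Descending from [2^l] to [2^(l-1)] takes [2^(l-1)] unit steps, each costing a factor [eps]. *)
Lemma weight_pow_pred l : (2 <= l)%N ->
  eps * weight (2 ^ l - 1) = ((3 * p)^-1) ^+ l.-2 * eps ^+ (2 ^ l.-1)%N.
Proof.
move=> l2; rewrite /weight trunc_log_pow_pred// mulrCA -exprS.
congr (_ * eps ^+ _).
have l0 : (2 ^ 1 <= 2 ^ l.-1)%N by rewrite leq_exp2l//; lia.
have -> : (2 ^ l = 2 * 2 ^ l.-1)%N by rewrite -expnS; congr (_ ^ _)%N; lia.
lia.
Qed.

Lemma triple_prob_pow l : (1 <= l)%N ->
  triple_prob p eps (2 ^ l) = p * (1 - down_prob l).
Proof.
move=> l1; rewrite /triple_prob /down_prob (_ : 2 ^ l %/ 2 = 2 ^ l.-1)%N//.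
by rewrite -{1}(prednK l1) expnS mulKn.
Qed.

Lemma trunc_log_non_dyadic n : (3 <= n)%N -> ~ dyadic_type n ->
  trunc_log 2 (n - 1) = trunc_log 2 n.
Proof.
move=> n3 ndy; have ln := non_dyadic_ltn n3 ndy.
apply: trunc_log_pow2; have := @trunc_log_ltn 2 n isT; lia.
Qed.

Lemma weight_non_dyadic n : (3 <= n)%N -> ~ dyadic_type n ->
  weight n = eps * weight (n - 1).
Proof.
move=> n3 ndy; rewrite /weight trunc_log_non_dyadic// mulrCA -exprS.
by congr (_ * eps ^+ _); have := non_dyadic_ltn n3 ndy; lia.
Qed.

Hypotheses (hp : 0 < p < 1) (heps : 0 < eps < 1) (hpe : 3 * p * eps ^+ 2 < 1).

Let p0 : 0 < p. Proof. by have /andP[] := hp. Qed.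
Let eps0 : 0 < eps. Proof. by have /andP[] := heps. Qed.
Let eps1 : eps < 1. Proof. by have /andP[] := heps. Qed.
Let q0 : 0 < 3 * p. Proof. by rewrite mulr_gt0. Qed.

Lemma down_prob_itv l : (2 <= l)%N -> 0 <= down_prob l < 1.
Proof.
move=> l2; apply/andP; split.
  by apply: mulr_ge0; [exact: ltW|rewrite exprn_ge0// ltW].
apply: le_lt_trans hpe; rewrite /down_prob ler_wpM2l ?(ltW q0)//.
rewrite ler_wiXn2l ?(ltW eps0) ?(ltW eps1)//.
by rewrite -{1}(expn1 2) leq_exp2l//; lia.
Qed.

Lemma down_prob_le (del : R) : 0 < del ->
  exists L, forall l, (L <= l)%N -> down_prob l <= del.
Proof.
move=> del0; have /(geometric_le (r := eps))[|L HL] : 0 < del / (3 * p) by rewrite divr_gt0.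
  by rewrite ltW.
exists L.+1 => l Ll; rewrite /down_prob mulrC -ler_pdivlMr//; apply: HL.
have : (l.-1 < 2 ^ l.-1)%N by exact: ltn_expl.
lia.
Qed.

Lemma weight_ge0 n : 0 <= weight n.
Proof. by rewrite mulr_ge0// exprn_ge0// ltW// invr_gt0. Qed.

(** The product [v x], with [x] extended to all types as a constant on each dyadic block. *)
Definition potential2 (x : nat -> R) (i : typ) : R :=
  weight (val i) * x (trunc_log 2 (val i)).

Section Potential2.
Variables (x : nat -> R) (B : R).
Hypotheses (xB : forall l, 1 <= x l <= B) (x12 : x 1 - x 2 = 1)
  (x_harm : forall l, (2 <= l)%N ->
     (1 - down_prob l) * x l.+1 + down_prob l * x l.-1 = x l).

Lemma potential2_ge0 i : 0 <= potential2 x i.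
Proof.
rewrite mulr_ge0 ?weight_ge0//.
by have /andP[/(le_trans ler01)] := xB (trunc_log 2 (val i)).
Qed.

Lemma potential2_pow l : (1 <= l)%N ->
  potential2 x (mkt (2 ^ l)) = ((3 * p)^-1) ^+ l.-1 * x l.
Proof.
move=> l1; have l2 : (2 <= 2 ^ l)%N by rewrite -{1}(expn1 2) leq_exp2l.
rewrite /potential2 val_mkt// weight_pow; congr (_ * x _).
by apply: trunc_log_pow2; rewrite leqnn ltn_exp2l/=.
Qed.

(** At type 2 the drop [x 1 - x 2 = 1] pays for the indicator, at other powers of 2 harmonicity of
    [x] applies, and inside a block [weight] is multiplied by [eps] at each step. Only upward moves
    can leave [keep], so replacement enters through the second hypothesis alone. *)
Lemma potential2P (keep : pred typ) (k : nat) :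
  (forall n, (2 <= n)%N -> keep (mkt n.+1) -> keep (mkt n)) ->
  (forall l, (1 <= l)%N -> keep (mkt (2 ^ l)) ->
     replace_mean (unif_mean k) keep (potential2 x) (mkt (2 ^ l.+1)) <=
     potential2 x (mkt (2 ^ l.+1))) ->
  forall i, keep i -> type_indic R 2 i +
    mean_op p eps (replace_mean (unif_mean k) keep (potential2 x)) i <=
    potential2 x i.
Proof.
move=> keepS Hup i ki; set Ru := replace_mean _ _ _.
have qV : 3 * p * (3 * p)^-1 = 1 by rewrite mulfV// gt_eqF.
rewrite /type_indic /mean_op; case: eqP => [i2|/eqP i2].
  have {ki}ki : keep (mkt (2 ^ 1)%N) by rewrite -i2 mkt_val.
  have := Hup 1%N isT ki; rewrite -/Ru potential2_pow//= expr1 => Ru4.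
  rewrite -[in leRHS](mkt_val i) i2 (potential2_pow (l := 1))//= expr0 mul1r.
  have : 3 * p * Ru (mkt 4) <= 3 * p * ((3 * p)^-1 * x 2) by rewrite ler_wpM2l// ltW.
  rewrite mulrA qV; move: x12; lra.
have n3 : (3 <= val i)%N by rewrite ltn_neqAle eq_sym i2 (valP i).
(* The child one type below is kept, by downward closure, and so is not replaced. *)
have Rpred : Ru (mkt (val i - 1)) = potential2 x (mkt (val i - 1)).
  rewrite /Ru /replace_mean keepS//; first by lia.
  by rewrite (_ : (val i - 1).+1 = val i) ?mkt_val//; lia.
rewrite add0r; case: ifPn => [/asboolP|/asboolP ndy]; last first.
  rewrite Rpred /potential2 val_mkt; last by lia.
  by rewrite trunc_log_non_dyadic// mulrA -weight_non_dyadic.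
move=> [l l2 il].
have {ki}ki : keep (mkt (2 ^ l)) by rewrite -il mkt_val.
have := Hup l (ltnW l2) ki; rewrite -/Ru potential2_pow//= => Rup.
rewrite -[in leRHS](mkt_val i) Rpred il potential2_pow//; last exact: ltnW.
rewrite /potential2 val_mkt; last by rewrite -il; lia.
rewrite trunc_log_pow_pred// mulrA weight_pow_pred// (il : sval i = (2 ^ l)%N) -expnS.
rewrite triple_prob_pow; last exact: ltnW.
have /andP[_ d1] := down_prob_itv l2.
have h : 3 * (p * (1 - down_prob l)) * Ru (mkt (2 ^ l.+1)) <=
    3 * (p * (1 - down_prob l)) * ((3 * p)^-1 ^+ l * x l.+1).
  apply: ler_wpM2l => //; apply: mulr_ge0 => //.
  by apply: mulr_ge0; [exact: ltW|rewrite subr_ge0 ltW].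
apply: le_trans (lerD (lexx _) h) _.
rewrite -(x_harm l2) le_eqVlt; apply/orP; left; apply/eqP.
case: l l2 {il ki Rup d1 h} => [|[|l]]//= _.
rewrite /down_prob /= !exprS.
field.
by rewrite gt_eqF.
Qed.

End Potential2.

End Weight.

(** * Replacement and survival *)

Section UniformWeight.
Context {R : realType} (p eps : R).
Hypotheses (hp : 0 < p < 1) (heps : 0 < eps < 1).

Let p0 : 0 < p. Proof. by have /andP[] := hp. Qed.
Let eps0 : 0 < eps. Proof. by have /andP[] := heps. Qed.
Let eps1 : eps < 1. Proof. by have /andP[] := heps. Qed.
Let q0 : 0 < 3 * p. Proof. by rewrite mulr_gt0. Qed.

(** Within a dyadic block the weights are geometric with ratio [eps], so [(1 - eps)] times their sum
    telescopes to the leading weight minus [eps] times the last one. This correction is retained for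
    the current block and dropped for completed ones. *)
Lemma sum_weight k : (2 <= k)%N ->
  (1 - eps) * \sum_(2 <= n < k.+1) weight p eps n <=
  \sum_(1 <= l < (trunc_log 2 k).+1) ((3 * p)^-1) ^+ l.-1 - eps * weight p eps k.
Proof.
elim: k => [//|k IHk]; rewrite ltnS leq_eqVlt => /orP[/eqP <-|k2].
  rewrite big_nat1 (@trunc_log_pow2 1)// big_nat1.
  by rewrite /weight (@trunc_log_pow2 1)//= !expr0; lra.
rewrite big_nat_recr; last by rewrite ltnW.
rewrite mulrDr; move: (IHk k2) => {}IHk.
have k3 : (3 <= k.+1)%N by [].
have [[l l2 kl]|ndy] := pselect (dyadic_type k.+1); last first.
  have := trunc_log_non_dyadic k3 ndy; rewrite subn1/= => <-.
  have := weight_non_dyadic p eps k3 ndy; rewrite subn1/= => ->.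
  by move: IHk; lra.
have kE : k = (2 ^ l - 1)%N by rewrite -kl subn1.
have w0 : 0 <= eps * weight p eps k by rewrite mulr_ge0 ?weight_ge0// ltW.
apply: le_trans (_ : _ <= \sum_(1 <= l0 < l) (3 * p)^-1 ^+ l0.-1 +
  (1 - eps) * weight p eps k.+1) _.
  rewrite lerD2r; apply: le_trans IHk _; rewrite kE trunc_log_pow_pred//.
  by rewrite prednK ?(ltnW l2)//; move: w0; rewrite kE; lra.
rewrite kl (@trunc_log_pow2 l (2 ^ l)); last by rewrite leqnn ltn_exp2l/=.
rewrite [in leRHS]big_nat_recr//=; last by rewrite ltnW.
rewrite weight_pow; lra.
Qed.

(** After multiplication by [(3p)^K] the sum is that of [(3p)^j] for [1 <= j <= K], which is
    compared with the geometric sum of [b]; this treats [3p] below, at and above 1 together. *)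
Lemma sum_weight_pow_le (b : R) K : 1 <= b -> 3 * p <= b ->
  (b - 1) * ((3 * p) ^+ K * \sum_(1 <= l < K.+1) ((3 * p)^-1) ^+ l.-1) <=
  b ^+ K.+1 - b.
Proof.
move=> b1 qb; elim: K => [|K IHK].
  by rewrite big_geq// !mulr0 expr1 subrr.
rewrite big_nat_recr//=; move: IHK; set A := \sum_(_ <= _ < _) _ => IHK.
have -> : (3 * p) ^+ K.+1 * (A + (3 * p)^-1 ^+ K) =
    3 * p * ((3 * p) ^+ K * A) + 3 * p.
  rewrite mulrDr exprS -!mulrA; congr (3 * (p * _) + _).
  by rewrite -exprMn mulfV ?gt_eqF// expr1n mulr1.
have cb : 0 <= b ^+ K.+1 - b + (b - 1).
  by rewrite addrA subrK subr_ge0 exprn_ege1.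
rewrite [b ^+ K.+2]exprS.
move: ((3 * p) ^+ K * A) IHK => a IHK.
move: (b ^+ K.+1) (3 * p) IHK cb q0 qb => c q IHK cb q0' qb.
have h1 : q * ((b - 1) * a) <= q * (c - b) by rewrite ler_wpM2l// ltW.
have h2 : q * (c - b + (b - 1)) <= b * (c - b + (b - 1)) by rewrite ler_wpM2r.
lra.
Qed.

Lemma unif_mean_weight_le (B : R) : p < 2 / 3 -> 0 < B ->
  exists K0, forall k l, (K0 <= k)%N -> (1 <= l)%N -> (2 ^ l <= k < 2 ^ l.+1)%N ->
    B * ((\sum_(2 <= n < k.+1) weight p eps n) / (k.-1)%:R) <=
    ((3 * p)^-1) ^+ l.
Proof.
move=> p23 B0.
(* The midpoint of [3p] and 2; it is below 2 exactly because [p < 2/3]. *)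
have [b [b1 b2 qb]] : exists b : R, [/\ 1 < b, b < 2 & 3 * p <= b].
  by exists (1 + 3 * p / 2); split; move: p0; lra.
(* This threshold for [(b/2)^l], combined with [2^l <= 2 (k - 1)], yields the bound [bl] on
   [b^(l+1)]. *)
have C0 : 0 < (1 - eps) * (b - 1) / (2 * B * b).
  by rewrite divr_gt0 ?mulr_gt0//; move: eps1; lra.
have [|L HL] := geometric_le (r := b / 2) _ C0; first by apply/andP; split; lra.
(* From [2^L <= k < 2^(l+1)] follows [L <= l]. *)
exists (2 ^ L)%N => k l Lk l1 /andP[lk kl].
have {}HL : (b / 2) ^+ l <= (1 - eps) * (b - 1) / (2 * B * b).
  by apply: HL; rewrite -ltnS -(@ltn_exp2l 2)//; exact: leq_ltn_trans kl.
have k2 : (2 <= k)%N by apply: leq_trans lk; rewrite -{1}(expn1 2) leq_exp2l.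
have k10 : 0 < (k.-1)%:R :> R by rewrite ltr0n -subn1 subn_gt0.
have k1l : 2 ^+ l <= 2 * (k.-1)%:R :> R.
  rewrite -natrX -natrM ler_nat; apply: leq_trans lk _.
  by rewrite -subn1 mulnBr muln1 mul2n -addnn -addnBA// leq_addr.
set W := \sum_(_ <= _ < _) _.
have [A WA Ab] : exists2 A, (1 - eps) * W <= A &
    (b - 1) * ((3 * p) ^+ l * A) <= b ^+ l.+1 - b.
  eexists; last exact: sum_weight_pow_le (ltW b1) qb.
  have := sum_weight k2; rewrite (@trunc_log_pow2 l) ?lk// => /le_trans; apply.
  by rewrite gerBl mulr_ge0 ?weight_ge0// ltW.
have bl : b ^+ l.+1 <= (1 - eps) * (b - 1) / B * (k.-1)%:R.
  have -> : (1 - eps) * (b - 1) / B * (k.-1)%:R =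
      b * ((1 - eps) * (b - 1) / (2 * B * b) * (2 * (k.-1)%:R)).
    by field; rewrite !gt_eqF//; move: eps1; lra.
  rewrite exprS ler_wpM2l//; first lra.
  rewrite -[leLHS](_ : (b / 2) ^+ l * 2 ^+ l = _); last first.
    by rewrite -exprMn divfK// pnatr_eq0.
  apply: ler_pM => //; first by rewrite exprn_ge0// divr_ge0//; lra.
have ql0 : 0 < (3 * p) ^+ l by rewrite exprn_gt0.
rewrite mulrA ler_pdivrMr// exprVn ler_pdivlMl//.
have D0 : 0 < (1 - eps) * (b - 1) by rewrite mulr_gt0// subr_gt0.
have h1 : (b - 1) * ((3 * p) ^+ l * ((1 - eps) * W)) <=
    (1 - eps) * (b - 1) / B * (k.-1)%:R.
  apply: le_trans bl; apply: le_trans (_ : _ <= b ^+ l.+1 - b) _; last by lra.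
  by apply: le_trans Ab; rewrite ler_pM2l ?subr_gt0// ler_pM2l.
have h2 : (3 * p) ^+ l * W <= (k.-1)%:R / B.
  rewrite -(ler_pM2l D0); apply: le_trans (le_trans h1 _); last by rewrite mulrAC -mulrA.
  by rewrite le_eqVlt; apply/orP; left; apply/eqP; ring.
by rewrite mulrCA mulrC -ler_pdivlMr.
Qed.


End UniformWeight.

(** * Survival with positive probability for [p > 1/3] *)

Section Survival.
Context {R : realType} (p eps : R).
Hypotheses (hp : 0 < p < 1) (heps : 0 < eps < 1) (hpe : 3 * p * eps ^+ 2 < 1).
Hypothesis p13 : 3^-1 < p.

Let p0 : 0 < p. Proof. by have /andP[] := hp. Qed.
Let p1 : p < 1. Proof. by have /andP[] := hp. Qed.
Let eps0 : 0 < eps. Proof. by have /andP[] := heps. Qed.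
Let eps1 : eps < 1. Proof. by have /andP[] := heps. Qed.

Let G : (typ -> R) -> typ -> R := fun s i => example_gf p eps i s.
Let f (n : nat) : typ -> R := iter n G (fun=> 0).

Hypothesis gf01 : forall t : typ -> R, (forall j, 0 <= t j <= 1) ->
  forall j, 0 <= example_gf p eps j t <= 1.

Let f01 n i : 0 <= f n i <= 1.
Proof. by elim: n i => [|n IHn] i /=; [rewrite lexx ler01|exact: gf01]. Qed.

Let f_pow1 n : f n.+1 (mkt (2 ^ 1)) = p * f n (mkt (2 ^ 2)) ^+ 3 + (1 - p).
Proof. by rewrite /= /G /example_gf val_mkt. Qed.

(** The factor contributed by the child of type [2^l - 1] is at most 1 and is dropped. *)
Let f_pow n l : (2 <= l)%N -> f n.+1 (mkt (2 ^ l)) <=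
  triple_prob p eps (2 ^ l) * f n (mkt (2 ^ l.+1)) ^+ 3 +
  (1 - triple_prob p eps (2 ^ l)).
Proof.
move=> l2; have l4 : (4 <= 2 ^ l)%N by exact: (@leq_pexp2l 2 2 l).
rewrite /= /G /example_gf val_mkt; last by apply: leq_trans l4.
rewrite ifF; last by apply/eqP => e; rewrite e in l4.
rewrite ifT; last by apply/asboolP; exact: dyadic_pow.
rewrite -/(triple_prob p eps (2 ^ l)) -expnS.
have /andP[] := triple_prob_itv hp heps hpe l4.
have /andP[] := f01 n (mkt (2 ^ l - 1)).
have /andP[t0 t1] := f01 n (mkt (2 ^ l.+1)).
have : f n (mkt (2 ^ l.+1)) ^+ 3 <= 1 by rewrite exprn_ile1.
have : 0 <= f n (mkt (2 ^ l.+1)) ^+ 3 by rewrite exprn_ge0.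
move: (_ ^+ 3) (triple_prob _ _ _) (f n (mkt (2 ^ l - 1))) => c a b c0 c1 b0 b1 a0 a1.
have : 0 <= eps * (1 - b) * (1 - a * (1 - c)).
  apply: mulr_ge0; first by apply: mulr_ge0; [exact: ltW|lra].
  have : a * (1 - c) <= 1 * (1 - c) by rewrite ler_wpM2r//; lra.
  lra.
lra.
Qed.

Let f_non_dyadic n i : val i != 2%N -> ~ dyadic_type (val i) ->
  f n.+1 i = eps * f n (mkt (val i - 1)) + (1 - eps).
Proof.
move=> i2 ndy; rewrite /= /G /example_gf (negbTE i2) ifF//.
exact/negbTE/asboolPn.
Qed.

Lemma bounded_pow_large : exists L (s : R), [/\ (2 <= L)%N, s < 1 &
  forall n l, (L <= l)%N -> f n (mkt (2 ^ l)) <= s].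
Proof.
have q1 : 1 < 3 * p by move: p13; lra.
have qV1 : (3 * p)^-1 < 1 by rewrite invf_lt1//; lra.
(* With this choice [3a] is the midpoint of 1 and [3p], hence above 1. *)
pose del := (1 - (3 * p)^-1) / 2.
have del0 : 0 < del by rewrite /del; lra.
have [L HL] := down_prob_le hp heps hpe del0.
pose a := p * (1 - del); pose s := (3 * a)^-1.
have a1 : 1 < 3 * a.
  have -> : 3 * a = 1 + (3 * p - 1) / 2.
    by rewrite /a /del; field; rewrite gt_eqF.
  lra.
have s0 : 0 < s by rewrite invr_gt0; lra.
have s1 : s < 1 by rewrite invf_lt1//; lra.
have sa : 3 * a * s = 1 by rewrite mulfV// gt_eqF//; lra.
(* Since [3 a s = 1], the quantity [3 s (a (1 - s^3) - (1 - s))] equals [(1 - s)^3]. *)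
have fix_s : 1 - a * (1 - s ^+ 3) <= s.
  have : 0 <= 3 * s * (a * (1 - s ^+ 3) - (1 - s)).
    have -> : 3 * s * (a * (1 - s ^+ 3) - (1 - s)) =
      (3 * a * s) * (1 - s ^+ 3) - 3 * s * (1 - s) by ring.
    rewrite sa; have -> : 1 * (1 - s ^+ 3) - 3 * s * (1 - s) = (1 - s) ^+ 3 by ring.
    by rewrite exprn_ge0// subr_ge0 ltW.
  by rewrite pmulr_rge0 ?mulr_gt0//; lra.
exists (maxn L 2), s; split; [exact: leq_maxr|exact: s1|].
(* The induction on [n] treats all large [l] at once: iterate [n.+1] at [2^l] involves iterate [n]
   at [2^(l+1)]. *)
elim=> [l _|n IHn l]; first exact: ltW.
rewrite geq_max => /andP[Ll l2].
apply: le_trans (f_pow n l2) _; apply: le_trans fix_s.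
have tb : a <= triple_prob p eps (2 ^ l).
  by rewrite triple_prob_pow ?(ltnW l2)// ler_pM2l// lerD2l lerN2 HL.
have /andP[t0 t1] := f01 n (mkt (2 ^ l.+1)).
have ts : f n (mkt (2 ^ l.+1)) ^+ 3 <= s ^+ 3.
  by rewrite lerXn2r ?nnegrE ?(ltW s0)//; apply: IHn; rewrite geq_max leqW//= ltnW.
have s31 : s ^+ 3 <= 1 by rewrite exprn_ile1// ltW.
have : a * (1 - s ^+ 3) <=
    triple_prob p eps (2 ^ l) * (1 - f n (mkt (2 ^ l.+1)) ^+ 3).
  by apply: ler_pM => //; lra.
lra.
Qed.

Let cube_step (a b : R) : 0 < a <= 1 -> 0 <= b < 1 ->
  0 <= a * b ^+ 3 + (1 - a) < 1.
Proof.
move=> /andP[a0 a1] /andP[b0 b1].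
have : a * b ^+ 3 < a * 1 by rewrite ltr_pM2l// exprn_ilt1.
have : 0 <= a * b ^+ 3 by rewrite mulr_ge0 ?(ltW a0)// exprn_ge0.
by move=> *; apply/andP; split; lra.
Qed.

(** Descending induction from [L]: a bound [b < 1] at [2^(l+1)] gives [a b^3 + 1 - a < 1] at [2^l],
    because the probability [a] of three children is positive. *)
Lemma bounded_pow l : (1 <= l)%N ->
  exists2 b : R, 0 <= b < 1 & forall n, f n (mkt (2 ^ l)) <= b.
Proof.
have [L [s [L2 s1 Ls]]] := bounded_pow_large.
have [Ll l1|] := leqP L l.
  exists s; last by move=> n; exact: Ls.
  by rewrite s1 andbT; exact: (Ls 0%N l Ll).
move=> /ltnW/subnKC.
move: (L - l)%N => m; elim: m l => [|m IHm] l lmL l1.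
  exists s; last by move=> n; apply: Ls; rewrite -lmL addn0.
  by rewrite s1 andbT; apply: (Ls 0%N L).
have [||b /andP[b0 b1] Hb] := IHm l.+1; [by rewrite addSnnS|by []|].
have cube n : 0 <= f n (mkt (2 ^ l.+1)) ^+ 3 <= b ^+ 3.
  have /andP[t0 _] := f01 n (mkt (2 ^ l.+1)).
  by rewrite exprn_ge0//= lerXn2r ?nnegrE.
have [l2|] := leqP 2 l; last first.
  rewrite ltnS leq_eqVlt ltnS [(l <= 0)%N]leqNgt l1 orbF => /eqP l1'.
  have cs : 0 <= p * b ^+ 3 + (1 - p) < 1.
    by apply: cube_step; [rewrite p0 ltW|rewrite b0].
  subst l; exists (p * b ^+ 3 + (1 - p)) => //.
  case=> [|n]; first by have /andP[] := cs.
  by rewrite f_pow1 lerD2r ler_pM2l//; have /andP[] := cube n.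
have l4 : (4 <= 2 ^ l)%N by exact: (@leq_pexp2l 2 2 l).
have /andP[a0 a1] := triple_prob_itv hp heps hpe l4.
have a0' : 0 < triple_prob p eps (2 ^ l).
  rewrite triple_prob_pow; last exact: ltnW.
  have /andP[_ d1] := down_prob_itv hp heps hpe l2.
  by rewrite mulr_gt0// subr_gt0.
have cs := cube_step (introT andP (conj a0' a1)) (introT andP (conj b0 b1)).
exists (triple_prob p eps (2 ^ l) * b ^+ 3 + (1 - triple_prob p eps (2 ^ l))) => //.
case=> [|n]; first by have /andP[] := cs.
apply: le_trans (f_pow n l2) _; rewrite lerD2r ler_pM2l//.
by have /andP[] := cube n.
Qed.

(** The bound is uniform in [n], so it passes to the limit and bounds the extinction probability
    strictly below 1. *)
Lemma iter_example_gf0_bounded i :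
  exists2 b : R, b < 1 & forall n, iter n G (fun=> 0) i <= b.
Proof.
suff: forall m, (2 <= m)%N ->
    exists2 b : R, 0 <= b < 1 & forall n, f n (mkt m) <= b.
  by move=> /(_ _ (valP i))[b /andP[_ b1] Hb]; exists b => // n;
    move: (Hb n); rewrite mkt_val.
elim=> [//|m IHm] m2.
(* The exponent 1 is included here, whereas [dyadic_type] starts at 4. *)
have [[l [l1 ml]]|npow] := pselect (exists l, (1 <= l)%N /\ m.+1 = (2 ^ l)%N).
  by rewrite ml; exact: bounded_pow.
have m3 : m.+1 != 2%N by apply/eqP => m1; apply: npow; exists 1%N.
have ndy : ~ dyadic_type m.+1.
  by move=> [l l2 ml]; apply: npow; exists l; rewrite ltnW.
have [|b /andP[b0 b1] Hb] := IHm.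
  by rewrite ltnNge; apply/negP => m1; move: m3 m2; rewrite eqn_leq !ltnS m1 /= => /negbTE ->.
have eb : eps * b < eps * 1 by rewrite ltr_pM2l.
have eb0 : 0 <= eps * b by rewrite mulr_ge0// ltW.
exists (eps * b + (1 - eps)); first by apply/andP; split; move: eps1; lra.
case=> [|n]; first by rewrite /=; move: eps1; lra.
by rewrite f_non_dyadic ?val_mkt// subn1/= lerD2r ler_pM2l.
Qed.

End Survival.

(** * Almost sure behaviour *)

Lemma cvg_nat0P (u : nat -> nat) :
  (u n @[n --> \oo] --> 0%N) <-> exists N, forall n, (N <= n)%N -> u n = 0%N.
Proof.
split=> [u0|[N uN]].
  have [N _ uN] := u0 _ (discrete_set1 0%N); exists N => n Nn.
  exact: uN.
by apply: cvg_near_cst; exists N.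
Qed.

Section Absorption.
Context {R : realType} {d : measure_display} {T : measurableType d}.
Variable P : probability T R.

Section Countable.
Context {S : countType}.

Lemma integral_mset_monomial_event (Y : T -> {mset S}) (s : S -> R)
    (B : set {mset S}) : discrete_rv Y ->
  (forall z, mset_monomial s z = \1_B z) ->
  (\int[P]_w (mset_monomial s (Y w))%:E = P (Y @^-1` B))%E.
Proof.
move=> mY sB.
have -> : (fun w => (mset_monomial s (Y w))%:E) = EFin \o \1_(Y @^-1` B).
  by apply/funext => w; rewrite /= sB !indicE.
by rewrite integral_indic ?setIT//; exact: discrete_rvP.
Qed.

(** Since [0^0 = 1] only for absent types, evaluating a generating function at 0 gives the
    probability of an empty population. *)
Lemma mset_monomial_mset0 (z : {mset S}) :
  mset_monomial (fun=> 0 : R) z = \1_[set mset0] z.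
Proof.
rewrite indicE; case: (eqVneq z mset0) => [->|z0].
  by rewrite mset_monomial0 mem_set.
rewrite memNset/=; last by apply/eqP.
have [j jz] : exists j, j \in z.
  by have [z0'|[j jz]] := mset_0Vmem z; [rewrite z0' eqxx in z0|exists j].
have jz' : j \in finsupp z by rewrite msuppE.
rewrite /mset_monomial (big_fsetD1 _ jz')/= expr0n.
by rewrite mset_eq0 jz mul0r.
Qed.

Lemma extinctionE (Y : nat -> T -> {mset S}) :
  (forall n w, Y n w = mset0 -> Y n.+1 w = mset0) ->
  [set w | size (Y n w) @[n --> \oo] --> 0%N] =
  \bigcup_n (Y n @^-1` [set mset0]).
Proof.
move=> Yabs; apply/seteqP; split=> w /=.
  move=> /cvg_nat0P[N YN]; exists N => //=; apply/eqP.
  by rewrite -size_mset_eq0; apply/eqP; exact: YN.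
move=> [N _ /= YN]; apply/cvg_nat0P; exists N => n /subnKC <-.
elim: (n - N)%N => [|m IHm]; first by rewrite addn0 YN size_mset0.
by rewrite addnS Yabs ?size_mset0//; apply/eqP; rewrite -size_mset_eq0 IHm.
Qed.

Lemma mset_bind0 (f : S -> nat -> {mset S}) : mset_bind f mset0 = mset0.
Proof. by rewrite /mset_bind finsupp0 big_seq_fset0. Qed.

Variable Y : nat -> T -> {mset S}.
Hypotheses (mY : forall n, discrete_rv (Y n))
  (Yabs : forall n w, Y n w = mset0 -> Y n.+1 w = mset0).

Let measurable_extinct n : measurable (Y n @^-1` [set mset0]).
Proof. exact: discrete_rvP. Qed.

Lemma extinction_le (b : R) :
  (forall n, P (Y n @^-1` [set mset0]) <= b%:E)%E ->
  (P [set w | size (Y n w) @[n --> \oo] --> 0%N] <= b%:E)%E.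
Proof.
move=> Yb; rewrite extinctionE//.
have Ycvg : P (Y n @^-1` [set mset0]) @[n --> \oo] -->
    P (\bigcup_n (Y n @^-1` [set mset0])).
  apply: nondecreasing_cvg_mu => //; first exact: bigcupT_measurable.
  by apply/nondecreasing_seqP => n; apply/subsetPset => w /=; exact: Yabs.
rewrite -(cvg_lim _ Ycvg)//; apply: lime_le; first by apply/cvg_ex; eexists; exact: Ycvg.
exact: nearW.
Qed.

Lemma extinction_ge n : (P (Y n @^-1` [set mset0]) <=
  P [set w | size (Y n w) @[n --> \oo] --> 0%N])%E.
Proof.
rewrite extinctionE//; apply: le_measure; rewrite ?inE//.
  exact: bigcupT_measurable.
by move=> w Yw; exists n.
Qed.

(** Each [1 - a n] is at least the survival probability; were that positive, the partial sums would
    be unbounded. *)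
Lemma extinction1 (a : nat -> R) (C : R) :
  (forall n, P (Y n @^-1` [set mset0]) = (a n)%:E) ->
  (forall m, \sum_(n < m) (1 - a n) <= C) ->
  (P [set w | size (Y n w) @[n --> \oo] --> 0%N] = 1)%E.
Proof.
move=> Ya aC; set E := [set w | _].
have mE : measurable E by rewrite /E extinctionE//; exact: bigcupT_measurable.
have PE1 := probability_le1 P mE.
have PEfin : P E \is a fin_num by exact: fin_num_measure.
have ale n : a n <= fine (P E).
  by rewrite -lee_fin fineK// -Ya; exact: extinction_ge.
apply/eqP; rewrite eq_le PE1/= -(fineK PEfin) lee_fin leNgt; apply/negP => e1.
have del0 : 0 < 1 - fine (P E) by rewrite subr_gt0.
have C0 : 0 <= C by have := aC 0%N; rewrite big_ord0.
have [m mC] : exists m : nat, C < (1 - fine (P E)) * m%:R.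
  exists (Num.truncn (C / (1 - fine (P E)))).+1.
  by rewrite mulrC -ltr_pdivrMr// truncnS_gt.
have := aC m; rewrite leNgt => /negP; apply; apply: lt_le_trans mC _.
rewrite -[m in m%:R]card_ord mulr_natr -sumr_const.
by apply: ler_sum => n _; rewrite lerD2l lerN2.
Qed.

End Countable.

Lemma mset_monomial_no_type (l : nat) (z : {mset typ}) : (2 <= l)%N ->
  mset_monomial (fun j => 1 - type_indic R l j) z =
  \1_[set z : {mset typ} | z (mkt l) = 0%N] z.
Proof.
move=> l2; rewrite indicE.
have s1 j : j != mkt l -> 1 - type_indic R l j = 1.
  move=> /negP jl; rewrite /type_indic; case: eqP => [jl'|_]; last by rewrite subr0.
  by case: jl; rewrite -jl' mkt_val.
have [zl|zl] := eqVneq (z (mkt l)) 0%N.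
  rewrite mem_set//= /mset_monomial big_seq big1// => j jz.
  rewrite s1 ?expr1n//; apply: contraTneq jz => ->.
  by rewrite memNfinsupp; apply/eqP.
rewrite memNset/=; last by apply/eqP.
have lz : mkt l \in finsupp z by rewrite mem_finsupp.
rewrite /mset_monomial (big_fsetD1 _ lz)/= /type_indic val_mkt// eqxx subrr.
by rewrite expr0n (negbTE zl) mul0r.
Qed.

(** Borel-Cantelli for each type: the probabilities that type [l] is present in generation [n] are
    summable over [n]. A countable union over the types concludes. *)
Lemma all_types_vanish (Y : nat -> T -> {mset typ}) :
  (forall n, discrete_rv (Y n)) ->
  (forall l, (2 <= l)%N -> exists (a : nat -> R) (C : R),
    (forall n, \int[P]_w
       (mset_monomial (fun j => 1 - type_indic R l j) (Y n w))%:E = (a n)%:E)%E /\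
    forall m, \sum_(n < m) (1 - a n) <= C) ->
  (P [set w | forall l : typ, Y n w l @[n --> \oo] --> 0%N] = 1)%E.
Proof.
move=> mY sumY.
pose F l n : set T := Y n @^-1` [set z | z (mkt l) != 0%N].
have mF l n : measurable (F l n) by exact: discrete_rvP.
(* The shift by 2 makes [l] range over all of [nat] while the labels start at 2. *)
pose A := \bigcup_l lim_sup_set (F l.+2).
have mlim l : measurable (lim_sup_set (F l)).
  by apply: bigcapT_measurable => n; exact: bigcup_measurable.
have mA : measurable A by exact: bigcupT_measurable.
have -> : [set w | forall l : typ, Y n w l @[n --> \oo] --> 0%N] = ~` A.
  apply/seteqP; split=> w /=.
    move=> Yw [l _ Fw]; have /cvg_nat0P[N YN] := Yw (mkt l.+2).
    have [n /= Nn] := Fw N I.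
    by rewrite /F /= YN.
  move=> nA l; apply/cvg_nat0P; apply: contrapT => nN; apply: nA.
  exists (val l - 2)%N => // N _; apply: contrapT => nF; apply: nN.
  exists N => n Nn; apply/eqP; apply: contrapT => Yn; apply: nF.
  exists n => //=; rewrite /F /=.
  have -> : (val l - 2).+2 = val l by have := valP l; lia.
  by rewrite mkt_val; apply/negP.
rewrite probability_setC//.
suff -> : P A = 0%E by rewrite sube0.
apply/negligibleP => //; apply: negligible_bigcup => l; apply/negligibleP => //.
apply: lim_sup_set_cvg0 => //.
have [a [C [Ya aC]]] := sumY l.+2 isT.
have PF n : P (F l.+2 n) = (1 - a n)%:E.
  have -> : F l.+2 n = ~` (Y n @^-1` [set z | z (mkt l.+2) = 0%N]).
    by apply/seteqP; split=> w /= /eqP.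
  rewrite probability_setC; last exact: discrete_rvP.
  rewrite -(@integral_mset_monomial_event _ _ (fun j => 1 - type_indic R l.+2 j))//.
    by rewrite Ya.
  by move=> z; rewrite mset_monomial_no_type.
apply: le_lt_trans (ltry C); apply: lime_le; first exact: is_cvg_nneseries.
apply: nearW => m.
rewrite big_mkord (eq_bigr (fun n : 'I_m => (1 - a n)%:E)) => [|n _]; last exact: PF.
by rewrite sumEFin lee_fin; exact: aC.
Qed.

End Absorption.

(** * The three assertions for the example *)

Section Example.
Context {R : realType} (p eps : R) (off : typ -> {mset typ} -> R).
Hypotheses (hp : 0 < p < 1) (heps : 0 < eps < 1) (hpe : 3 * p * eps ^+ 2 < 1)
  (hG : forall (i : typ) (s : typ -> R), (forall j, 0 <= s j <= 1) ->
     progeny_gf (off i) s = (example_gf p eps i s)%:E).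

Variable Z : galton_watson off.

Let gf01 (t : typ -> R) : (forall j, 0 <= t j <= 1) ->
  forall j, 0 <= example_gf p eps j t <= 1.
Proof. by move=> t01 j; exact: (offspring_gf_itv Z hG t01 j). Qed.

Let G : (typ -> R) -> typ -> R := fun s i => example_gf p eps i s.

Let barrier : exists (x : nat -> R) (B : R),
  [/\ forall l, 1 <= x l <= B, x 1 - x 2 = 1 &
    forall l, (2 <= l)%N ->
      (1 - down_prob p eps l) * x l.+1 + down_prob p eps l * x l.-1 = x l].
Proof.
have [|L HL] := down_prob_le hp heps hpe (del := 3^-1); first by rewrite invr_gt0.
apply: (transient_barrier _ HL) => l; exact: down_prob_itv.
Qed.

Lemma type_indic_itv (l : nat) (j : typ) : 0 <= 1 - type_indic R l j <= 1.
Proof. by rewrite /type_indic; case: (_ == _); rewrite ?subrr ?subr0 ?lexx ?ler01. Qed.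

Lemma partial_extinction_example (i : typ) :
  partial_extinction Z i = 1%E.
Proof.
have [x [B [xB x12 x_harm]]] := barrier.
have keepS n : (2 <= n)%N -> xpredT (mkt n.+1) -> xpredT (mkt n) by [].
(* With every type kept, replacement is the identity; 2 is the least admissible [k]. *)
have Rid (y : typ -> R) : replace_mean (unif_mean 2) xpredT y = y.
  by apply/funext => j; rewrite /replace_mean.
have hu2 : forall j, xpredT j -> type_indic R 2 j +
    mean_op p eps (replace_mean (unif_mean 2) xpredT (potential2 p eps x)) j <=
    potential2 p eps x j.
  by apply: (potential2P hp heps hpe x12 x_harm keepS) => l l1 _; rewrite Rid.
apply: all_types_vanish => [n|l l2]; first exact: gw_pop_rv.
have [u [u0 hu]] := potential_all_types (k := 2) hp heps hpe isT
  (fun _ _ => isT) keepS (potential2_ge0 hp heps xB) hu2 l2.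
exists (fun n => iter n G (fun j => 1 - type_indic R l j) i), (u i); split.
  by move=> n; rewrite (@gw_pop_gf _ _ _ _ G)//; exact: type_indic_itv.
move=> m; have := @sum_iter_le_potential _ _ _ hp heps hpe xpredT 2
  (fun _ _ => isT) (type_indic R l) u u0 hu m i isT.
apply: le_trans; apply: ler_sum => n _.
have [_] := @iter_gf_le_iter_mean _ _ _ hp heps hpe xpredT 2 isT
  (fun _ _ => isT) (fun j => 1 - type_indic R l j)
  gf01 (type_indic_itv l) n i.
rewrite (_ : (fun j => 1 - (1 - type_indic R l j)) = type_indic R l); last first.
  by apply/funext => j; rewrite subKr.
have -> : (fun t => example_gf p eps ^~ (replace_mean (unif_mean 2) xpredT t)) = G.
  by apply/funext => t; rewrite Rid.
by [].
Qed.

Lemma global_extinction_example : 3^-1 < p ->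
  forall i, (global_extinction Z i < 1)%E.
Proof.
move=> p13 i.
have [b b1 Hb] := iter_example_gf0_bounded hp heps hpe p13
  gf01 i.
apply: (@le_lt_trans _ _ b%:E); last by rewrite lte_fin.
apply: extinction_le => [n|n w|n].
- exact: gw_pop_rv.
- by rewrite /= => ->; rewrite mset_bind0.
rewrite -(@integral_mset_monomial_event _ _ _ (gw_P Z) _ (gw_pop i n) (fun=> 0)).
- rewrite (@gw_pop_gf _ _ _ _ G)//; first by rewrite lee_fin; exact: Hb.
  by move=> j; rewrite lexx ler01.
- exact: gw_pop_rv.
- exact: mset_monomial_mset0.
Qed.

(** The potentials of the single types from 2 to [K] are added up, which is legitimate because the
    operator is linear. *)
Lemma potential_bounded_types (keep : pred typ) (k : nat) (u2 : typ -> R) :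
  (2 <= k)%N -> (forall j : typ, (val j <= k)%N -> keep j) ->
  (forall n, (2 <= n)%N -> keep (mkt n.+1) -> keep (mkt n)) ->
  (forall j, 0 <= u2 j) ->
  (forall i, keep i -> type_indic R 2 i +
    mean_op p eps (replace_mean (unif_mean k) keep u2) i <= u2 i) ->
  forall K, exists u : typ -> R, (forall j, 0 <= u j) /\
    forall i, keep i -> (val i <= K)%:R +
      mean_op p eps (replace_mean (unif_mean k) keep u) i <= u i.
Proof.
move=> k2 keepk keepS u20 hu2; elim=> [|K [u [u0 hu]]].
  exists u2; split=> // i ki; apply: le_trans (hu2 i ki); rewrite lerD2r.
  by rewrite leqNgt (ltnW (valP i)).
have [K2|K1] := leqP 2 K.+1; last first.
  exists u; split=> // i ki; apply: le_trans (hu i ki); rewrite lerD2r.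
  have Ki : (K.+1 < val i)%N by exact: leq_trans K1 (valP i).
  by rewrite (leqNgt _ K.+1) (leqNgt _ K) Ki (ltnW Ki).
have [v [v0 hv]] := potential_all_types hp heps hpe k2 keepk keepS u20 hu2 K2.
exists (fun j => u j + v j); split=> [j|i ki]; first exact: addr_ge0.
rewrite replace_meanD mean_opD.
have -> : (val i <= K.+1)%:R = (val i <= K)%:R + type_indic R K.+1 i.
  by rewrite /type_indic leq_eqVlt ltnS; case: eqP => [->|_];
    rewrite ?ltnn ?add0r ?addr0.
by rewrite addrACA lerD ?hu ?hv.
Qed.

Lemma replaced_extinction_example : p < 2 / 3 ->
  forall Zbar : (forall k : nat, replaced_gw off k.+2 (unif_upto R k.+2)),
  forall i : typ, replaced_extinction (Zbar k) i @[k --> \oo] --> 1%E.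
Proof.
move=> p23 Zbar i.
have [x [B [xB x12 x_harm]]] := barrier.
have B0 : 0 < B by have /andP[/(lt_le_trans ltr01)/lt_le_trans] := xB 0%N; apply.
have [K0 HK0] := unif_mean_weight_le hp heps p23 B0.
(* Past [K0] the estimate of the mean weight holds, and past [val i] the ancestor is kept; the
   sequence is then constantly 1. *)
apply: cvg_near_cst; exists (maxn K0 (val i)) => // k /=.
rewrite geq_max => /andP[K0k ik].
pose K := k.+2; pose keep : pred typ := fun j => (val j <= K)%N.
have keepk (j : typ) : (val j <= K)%N -> keep j by [].
have keepS n : (2 <= n)%N -> keep (mkt n.+1) -> keep (mkt n).
  by move=> n2; rewrite /keep (val_mkt n2) (val_mkt (leqW n2)); exact: ltnW.
have ki : keep i by rewrite /keep /K (leq_trans ik)// -addn2 leq_addr.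
have weight_x n : 0 <= weight p eps n * x (trunc_log 2 n) <= B * weight p eps n.
  have w0 := weight_ge0 hp heps n; have /andP[x1 xb] := xB (trunc_log 2 n).
  apply/andP; split; last by rewrite mulrC ler_wpM2r.
  by apply: mulr_ge0 => //; exact: le_trans x1.
(* Either [2^(l+1)] is kept and nothing changes, or [2^l <= K < 2^(l+1)] and the mean weight
   estimate applies, using [x <= B] in the average and [1 <= x] at [2^(l+1)]. *)
have Hup l : (1 <= l)%N -> keep (mkt (2 ^ l)) ->
    replace_mean (unif_mean K) keep (potential2 p eps x) (mkt (2 ^ l.+1)) <=
    potential2 p eps x (mkt (2 ^ l.+1)).
  move=> l1; have l2 : (2 <= 2 ^ l)%N by rewrite -{1}(expn1 2) leq_exp2l.
  rewrite {1}/keep val_mkt// => lK; rewrite /replace_mean; case: ifPn => //.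
  rewrite /keep val_mkt; last by rewrite expnS; lia.
  rewrite -ltnNge => Kl; rewrite potential2_pow//=.
  have q0 : 0 <= (3 * p)^-1 ^+ l.
    by rewrite exprn_ge0// invr_ge0 mulr_ge0// ltW//; have /andP[] := hp.
  apply: (@le_trans _ _ ((3 * p)^-1 ^+ l)); last first.
    by rewrite ler_peMr//; have /andP[] := xB l.+1.
  apply: le_trans (HK0 K l _ l1 _); last by rewrite lK Kl.
    rewrite /unif_mean mulrA ler_wpM2r ?invr_ge0// mulr_sumr.
    rewrite big_nat_cond [leRHS]big_nat_cond; apply: ler_sum => n /andP[/andP[n2 _] _].
    by rewrite /potential2 val_mkt//; have /andP[] := weight_x n.
  by rewrite (leq_trans K0k)// /K -addn2 leq_addr.
have hu2 := potential2P hp heps hpe x12 x_harm keepS Hup.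
have [u [u0 hu]] := potential_bounded_types (k := K) isT keepk keepS
  (potential2_ge0 hp heps xB) hu2 K.
(* On kept types the indicator of labels up to [K] is 1, so [u] bounds the sum over generations of
   the expected population size, hence of the probability of being alive. *)
have {}hu j : keep j -> 1 + mean_op p eps (replace_mean (unif_mean K) keep u) j <= u j.
  by move=> kj; have := hu j kj; rewrite -/(keep j) kj.
have avgE s : (forall j : typ, 0 <= s j <= 1) ->
    (\esum_(j in [set: typ]) (s j * unif_upto R K j)%:E = (unif_mean K s)%:E)%E.
  by move=> s01; apply: unif_mean_esum => // j; have /andP[] := s01 j.
pose W := Zbar k.
have z01 (j : typ) : 0 <= (0 : R) <= 1 by rewrite lexx ler01.
apply: (@extinction1 _ _ _ (rp_P W) _ (@rp_pop _ _ _ _ W i)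
  _ _ (fun n => iter n (fun t => G (replace_mean (unif_mean K) keep t)) (fun=> 0) i) (u i)).
- by move=> n; exact: (@rp_pop_rv _ _ _ _ W i n).
- by move=> n w /= ->; rewrite mset_bind0 /replace_above mset_bind0.
- move=> n.
  rewrite -(@integral_mset_monomial_event _ _ _ (rp_P W) _ (@rp_pop _ _ _ _ W i n) (fun=> 0)).
  + rewrite (@rp_pop_gf _ _ _ _ W G (unif_mean K) hG avgE)//.
    by rewrite {1}/replace_mean -/(keep i) ki.
  + exact: (@rp_pop_rv _ _ _ _ W i n).
  + exact: mset_monomial_mset0.
- move=> m; have := @sum_iter_le_potential _ _ _ hp heps hpe keep K
    keepk (fun=> 1) u u0 hu m i ki.
  apply: le_trans; apply: ler_sum => n _.
  have [_] := @iter_gf_le_iter_mean _ _ _ hp heps hpe keep K isT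
    keepk (fun=> 0) gf01 z01 n i.
  by rewrite (_ : (fun j => 1 - 0) = fun=> 1)//; apply/funext => j; rewrite subr0.
Qed.

End Example.

Theorem proposition3 (R : realType) (p eps : R)
    (off : typ -> {mset typ} -> R)
    (hp : 0 < p < 1) (heps : 0 < eps < 1) (hpe : 3 * p * eps ^+ 2 < 1)
    (hoff : forall i, is_pmf (off i))
    (hG : forall (i : typ) (s : typ -> R), (forall j, 0 <= s j <= 1) ->
       progeny_gf (off i) s = (example_gf p eps i s)%:E)
    (Z : galton_watson off) :
  [/\ (forall i : typ, partial_extinction Z i = 1%E),
      (3^-1 < p -> forall i : typ, (global_extinction Z i < 1)%E)
    & (p < 2 / 3 ->
       forall Zbar : (forall k : nat, replaced_gw off k.+2 (unif_upto R k.+2)),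
       forall i : typ,
         replaced_extinction (Zbar k) i @[k --> \oo] --> 1%E)].
Proof.
split.
- by move=> i; exact: partial_extinction_example hp heps hpe hG Z i.
- by move=> p13 i; exact: global_extinction_example hp heps hpe hG Z p13 i.
- by move=> p23 Zbar i; exact: replaced_extinction_example hp heps hpe hG Z p23 Zbar i.
Qed.
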